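(* Let $M_1$ and $M_2$ be smooth manifolds (possibly with rough boundary) modelled on locally convex spaces $E_1$ and $E_2$ respectively, $F$ be a locally convex space and $r,s \in \mathbb{N}_0 \cup \{\infty \}$. Assume that $M_2$ is locally compact or that one of the following conditions is satisfied: (a) $r=s=0$ and $M_1 \times M_2$ is a $k$-space. (b) $r\geq 1$, $s=0$ and $M_1 \times M_2 \times E_1$ is a $k$-space. (c) $r=0$, $s\geq 1$ and $M_1 \times M_2 \times E_2$ is a $k$-space. (d) $r\geq 1$, $s\geq1$ and $M_1 \times M_2 \times E_1 \times E_2$ is a $k$-space. Then $$\Phi \colon C^{r,s}(M_1\times M_2,F)\to C^r(M_1,C^s(M_2,F)), \quad f \mapsto f^\vee,\qquad f^\vee(x):=f(x,\bullet),$$ is an isomorphism of topological vector spaces. Moreover, a map $g\colon M_1 \to C^s(M_2,F)$ is $C^r$ if and only if $$g^\wedge \colon M_1 \times M_2 \to F,\quad g^\wedge (x,y):= g(x)(y)$$ is $C^{r,s}$.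
   Context: Locally convex spaces are real Hausdorff locally convex topological vector spaces. A subset $U$ of a locally convex space $E$ is called locally convex if every $x\in U$ has a convex neighbourhood in $U$. ''With dense interior'' means that the interior $U^\circ$ is dense in $U$. $C^r$-maps: For $f\colon U\to F$ with $U\subseteq E$ open, $D_hf(x):=\lim_{t\to0}t^{-1}(f(x+th)-f(x))$. The map $f$ is $C^r$ if for all $k\in\mathbb{N}_0$ with $k\le r$ the iterated directional derivatives $d^{(k)}f(x,y_1,\dots,y_k):=(D_{y_k}\cdots D_{y_1}f)(x)$ exist and define a continuous map $d^{(k)}f\colon U\times E^k\to F$. If $U$ is a locally convex subset with dense interior, $f\colon U\to F$ is $C^r$ if $f|_{U^\circ}$ is $C^r$ and each $d^{(k)}(f|_{U^\circ})$ extends to a (unique) continuous map $d^{(k)}f\colon U\times E^k\to F$ (with $d^{(0)}f=f$). Smooth means $C^\infty$. $C^{r,s}$-maps: For $U\subseteq E_1$, $V\subseteq E_2$ open, $f\colon U\times V\to F$ is $C^{r,s}$ if for all $i,j\in\mathbb{N}_0$ with $i\le r$, $j\le s$ the iterated directional derivative $d^{(i,j)}f(x,y,w_1,\dots,w_i,v_1,\dots,v_j):=(D_{(w_i,0)}\cdots D_{(w_1,0)}D_{(0,v_j)}\cdots D_{(0,v_1)}f)(x,y)$ exists everywhere and $d^{(i,j)}f\colon U\times V\times E_1^i\times E_2^j\to F$ is continuous. If $U,V$ are locally convex subsets with dense interior, $f$ is $C^{r,s}$ if $f|_{U^\circ\times V^\circ}$ is $C^{r,s}$ and each $d^{(i,j)}(f|_{U^\circ\times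 V^\circ})$ extends to a continuous map $d^{(i,j)}f\colon U\times V\times E_1^i\times E_2^j\to F$ (with $d^{(0,0)}f=f$). Topologies on sets: $C^r(U,F)$ carries the initial topology with respect to the maps $d^{(k)}\colon C^r(U,F)\to C(U\times E^k,F)$, $k\le r$; $C^{r,s}(U\times V,F)$ carries the initial topology with respect to the maps $d^{(i,j)}\colon C^{r,s}(U\times V,F)\to C(U\times V\times E_1^i\times E_2^j,F)$, $i\le r$, $j\le s$ (spaces of continuous maps with the compact-open topology). Manifolds: A (smooth) manifold with rough boundary modelled on $E$ is a Hausdorff topological space $M$ with an atlas of smoothly compatible homeomorphisms $\phi\colon U_\phi\to V_\phi$ from open subsets $U_\phi\subseteq M$ onto locally convex subsets $V_\phi\subseteq E$ with dense interior. A map $f\colon M\to F$ to a locally convex space is $C^r$ if $f\circ\phi^{-1}\colon V_\phi\to F$ is $C^r$ for all charts $\phi$; $C^r(M,F)$ carries the initial topology with respect to the maps $C^r(M,F)\to C^r(V_\phi,F)$, $f\mapsto f\circ\phi^{-1}$. A map $f\colon M_1\times M_2\to F$ is $C^{r,s}$ if $f\circ(\varphi^{-1}\times\psi^{-1})\colon V_\varphi\times V_\psi\to F$ is $C^{r,s}$ for all charts $\varphi$ of $M_1$ and $\psi$ of $M_2$; the space $C^{r,s}(M_1\times M_2,F)$ of all such maps carries the initial topology with respect to the maps $C^{r,s}(M_1\times M_2,F)\to C^{r,s}(V_\varphi\times V_\psi,F)$, $f\mapsto f\circ(\varphi^{-1}\times\psi^{-1})$, for $\varphi,\psi$ in the maximal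 smooth atlases. A topological space $X$ is a k-space if it is Hausdorff and its topology is the final topology with respect to the inclusion maps $K\to X$ of compact subsets $K\subseteq X$. *)

(* Defs.v *)
From HB Require Import structures.
From mathcomp Require Import all_boot all_order all_algebra.
From mathcomp Require Import all_classical all_reals topology convex normedtype.

Set Implicit Arguments.
Unset Strict Implicit.
Unset Printing Implicit Defensive.

Import Order.TTheory GRing.Theory Num.Theory.
Import numFieldNormedType.Exports.

Local Open Scope classical_set_scope.
Local Open Scope ring_scope.

HB.mixin Record isHausdorffTvs (R : realType) E & Tvs R E := {
  hausdorffP : hausdorff_space E
}.

#[short(type="lcsType")]
HB.structure Definition LocallyConvexSpace (R : realType) :=
  {E of Tvs R E & isHausdorffTvs R E}.

Definition is_tvs_iso (R : realType) (V W : tvsType R)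
    (Phi : {linear V -> W}) : Prop :=
  exists Psi : W -> V,
    [/\ cancel Phi Psi, cancel Psi Phi, continuous Phi & continuous Psi].

Definition k_space (X : topologicalType) : Prop :=
  hausdorff_space X /\
  forall O : set X, open O <->
    forall K : set X, compact K -> open ((set_val : K -> X) @^-1` O).

Lemma compact_nearW (X : topologicalType) (U : Type) (G : set_system U)
    (K : set X) (P : U -> X -> Prop) {FG : Filter G} : compact K ->
  (forall x, K x -> \forall x' \near x & u \near G, K x' -> P u x') ->
  \forall u \near G, K `<=` P u.
Proof. by move/compact_near_coveringP/near_covering_withinP; apply. Qed.

(* Given linear operators D i from a vector space T to continuous functions
   Y i -> F that jointly separate points, `initial_lcs` is T with the initial
   topology with respect to the D i : T -> C(Y i, F), where C(Y i, F) carries the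
   compact-open topology.  It is shown to be a locally convex space. *)
Section InitialLcs.
Context (R : realType) (F : lcsType R) (T : lmodType R) (J : Type).
Context (Y : J -> topologicalType) (D : forall i, T -> Y i -> F).
Arguments D : clear implicits.

Definition ops_linear :=
  forall i a f g y, D i (a *: f + g) y = a *: D i f y + D i g y.
Definition ops_continuous := forall i f, continuous (D i f).
Definition ops_injective := forall f g, (forall i y, D i f y = D i g y) -> f = g.

Definition initial_lcs of ops_linear & ops_continuous & ops_injective : Type := T.

Definition initial_lcs_topology :=
  sup_topology (fun i => Topological.class
    (initial_topology (D i : T -> {compact-open, Y i -> F}))).

Hypotheses (linD : ops_linear) (contD : ops_continuous) (injD : ops_injective).

Local Notation W := (initial_lcs linD contD injD).

HB.instance Definition _ := GRing.Lmodule.copy W T.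
HB.instance Definition _ := Topological.copy W initial_lcs_topology.

Lemma initial_lcs_cvgP (G : set_system W) (f : W) : Filter G ->
  G --> f <-> forall i K O, compact K -> open O -> D i f @` K `<=` O ->
    G [set g | D i g @` K `<=` O].
Proof.
move=> FG; split.
  move=> /cvg_sup + i K O cK oO fKO => /(_ i); apply => /=.
  exists [set g | D i g @` K `<=` O]; split => //.
  exists [set g : {compact-open, Y i -> F} | g @` K `<=` O] => //.
  exact: compact_open_open.
move=> H; apply/cvg_sup => i A /= [_ [[C oC <-] Cf sCA]].
have : (D i @ G : set_system {compact-open, Y i -> F}) -->
       (D i f : {compact-open, Y i -> F}).
  by apply/compact_open_cvgP => K O cK oO fKO; exact: H.
move=> /(_ C) h; apply: filterS sCA _; apply: h.
exact: open_nbhs_nbhs.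
Qed.

Lemma initial_lcs_open i K O :
  compact K -> open O -> open [set g : W | D i g @` K `<=` O].
Proof.
move=> cK oO; rewrite openE => f fKO; rewrite /interior/=.
by have /initial_lcs_cvgP := @cvg_id _ (nbhs f); apply.
Qed.

Lemma evaluation_near (S : set (set F)) (G : set_system W) (f : W) i K x A :
  Filter G ->
  (forall K O, compact K -> open O -> S O -> D i f @` K `<=` O ->
    G [set g | D i g @` K `<=` O]) ->
  compact K -> open A -> S A -> A (D i f x) ->
  \forall x' \near x & g \near G, K x' -> A (D i g x').
Proof.
move=> FG GS cK oA SA Afx.
have [B Bfx BA] := uniform_regular (open_nbhs_nbhs (conj oA Afx)).
pose K' := K `&` D i f @^-1` closure B.
have cK' : compact K'.
  apply: compact_closedI => //; apply: preimage_closed; last exact: closed_closure.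
  by move=> ? _; exact: contD.
have fK' : D i f @` K' `<=` A by move=> _ [z [_ Bz] <-]; exact: BA.
exists (D i f @^-1` B, [set g | D i g @` K' `<=` A]); first split.
- exact: contD.
- exact: GS.
- move=> [x' g] /= [Bx' gK'] Kx'; apply: gK'; exists x' => //; split => //.
  exact: subset_closure.
Qed.

Lemma initial_lcs_eval_near (f : W) i K x A :
  compact K -> nbhs (D i f x) A ->
  \forall x' \near x & g \near f, K x' -> A (D i g x').
Proof.
move=> cK; rewrite nbhsE => -[B [oB Bfx] BA].
have H : forall K O, compact K -> open O -> [set: set F] O ->
    D i f @` K `<=` O -> nbhs f [set g : W | D i g @` K `<=` O].
  move=> K' O cK' oO _ fKO; apply: open_nbhs_nbhs; split => //.
  exact: initial_lcs_open.
have := @evaluation_near setT (nbhs f) f i K x B (nbhs_filter f) H cK oB I Bfx.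
by apply: filterS => -[x' g] /= h /h /BA.
Qed.

Lemma initial_lcs_add_continuous : continuous (fun p : W * W => p.1 + p.2).
Proof.
move=> [f g]; apply/initial_lcs_cvgP => i K O cK oO fKO.
have DD (p : W * W) x : D i (p.1 + p.2) x = D i p.1 x + D i p.2 x.
  by rewrite -[X in D i (X + _)](scale1r p.1) linD scale1r.
suff : \forall p \near (f, g), K `<=` [set x | O (D i (p.1 + p.2) x)].
  by apply: filterS => p /= pK _ [x Kx <-]; exact: pK.
apply: (@compact_nearW _ _ (nbhs ((f, g) : W * W)) K (fun p x => O (D i (p.1 + p.2) x)) (nbhs_filter _) cK) => x Kx.
have Ofg : nbhs (D i f x + D i g x) O.
  rewrite -(DD (f, g)); apply: open_nbhs_nbhs; split => //.
  by apply: fKO; exists x.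
have /= [[A B] /= [nA nB] AB] := @add_continuous F (D i f x, D i g x) O Ofg.
have [[P1 Q1] /= [P1x Q1f] H1] := initial_lcs_eval_near cK nA.
have [[P2 Q2] /= [P2x Q2f] H2] := initial_lcs_eval_near cK nB.
exists (P1 `&` P2, Q1 `*` Q2); first split => /=.
- exact: filterI.
- by exists (Q1, Q2).
- move=> [x' [f' g']] /= [[P1x' P2x'] [Qf' Qg']] Kx'; rewrite (DD (f', g')).
  by apply: (AB (_, _)); split => /=; [exact: (H1 (_, _))|exact: (H2 (_, _))].
Qed.

Lemma initial_lcs_scale_continuous :
  continuous (fun p : R^o * W => p.1 *: p.2).
Proof.
move=> [t f]; apply/initial_lcs_cvgP => i K O cK oO fKO.
have DZ (p : R^o * W) x : D i (p.1 *: p.2) x = p.1 *: D i p.2 x.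
  have D0 : D i 0 x = 0.
    have := @linD i 1 0 0 x; rewrite scaler0 addr0 scale1r => /eqP.
    by rewrite -subr_eq subrr => /eqP.
  by rewrite -[X in D i X]addr0 linD D0 addr0.
suff : \forall p \near (t, f), K `<=` [set x | O (D i (p.1 *: p.2) x)].
  by apply: filterS => p /= pK _ [x Kx <-]; exact: pK.
apply: (@compact_nearW _ _ (nbhs ((t, f) : R^o * W)) K (fun p x => O (D i (p.1 *: p.2) x)) (nbhs_filter _) cK) => x Kx.
have Ofg : nbhs (t *: D i f x) O.
  rewrite -(DZ (t, f)); apply: open_nbhs_nbhs; split => //.
  by apply: fKO; exists x.
have /= [[A B] /= [nA nB] AB] := @scale_continuous R F (t, D i f x) O Ofg.
have [[P2 Q2] /= [P2x Q2f] H2] := initial_lcs_eval_near cK nB.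
exists (P2, A `*` Q2); first split => //=.
  by exists (A, Q2).
move=> [x' [t' f']] /= [P2x' [At' Qf']] Kx'; rewrite (DZ (t', f')).
by apply: (AB (_, _)); split => //=; exact: (H2 (_, _)).
Qed.

Lemma initial_lcs_convex i K (A : set F) :
  convex_set A -> convex_set [set g : W | D i g @` K `<=` A].
Proof.
move=> cA f g l; rewrite !inE /= => fA gA _ [x Kx <-].
have D0 : D i 0 x = 0.
  have := @linD i 1 0 0 x; rewrite scaler0 addr0 scale1r => /eqP.
  by rewrite -subr_eq subrr => /eqP.
have DZ a h : D i (a *: h) x = a *: D i h x.
  by rewrite -[X in D i X]addr0 linD D0 addr0.
have -> : D i (conv l (f : convex_lmodType W) g) x =
    conv l (D i f x : convex_lmodType F) (D i g x).
  by rewrite /conv/= linD DZ.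
by apply/set_mem/cA; apply/mem_set; [apply: fA|apply: gA]; exists x.
Qed.

Lemma initial_lcs_locally_convex : exists2 B : set_system W,
  (forall b, b \in B -> convex_set b) & basis B.
Proof.
exists [set U | open U /\ convex_set U]; first by move=> b /set_mem [].
split; first by move=> ? [].
move=> f; set G := filter_from _ _.
have FG : Filter G.
  apply: filter_from_filter.
    exists setT; split => //; split; first exact: openT.
    by move=> ? ? ? ? ?; rewrite inE.
  move=> A B [[oA cA] Af] [[oB cB] Bf]; exists (A `&` B) => //; split => //.
  split; first exact: openI.
  move=> x y l; rewrite !inE => -[Ax Bx] [Ay By].
  by split; apply/set_mem; [apply: cA|apply: cB]; apply/mem_set.
apply/initial_lcs_cvgP => i K O cK oO fKO.
have [Bc Bcc [Bco Bcb]] := @locally_convex R F.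
suff : \forall g \near G, K `<=` [set x | O (D i g x)].
  by apply: filterS => p /= pK _ [x Kx <-]; exact: pK.
apply: (@compact_nearW _ _ G K (fun g x => O (D i g x)) FG cK) => x Kx.
have [] := Bcb (D i f x) O.
  by apply: open_nbhs_nbhs; split => //; apply: fKO; exists x.
move=> A [BA Af] AO.
have GH : forall K O, compact K -> open O -> convex_set O ->
    D i f @` K `<=` O -> G [set g : W | D i g @` K `<=` O].
  move=> K' O' cK' oO' cO' fO'; exists [set g : W | D i g @` K' `<=` O'] => //.
  split => //; split; first exact: initial_lcs_open.
  exact: initial_lcs_convex.
have := @evaluation_near (@convex_set R F) G f i K x A FG GH cK (Bco _ BA)
  (Bcc _ (mem_set BA)) Af.
by apply: filterS => -[x' g] /= h /h /AO.
Qed.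

Lemma initial_lcs_hausdorff : hausdorff_space W.
Proof.
move=> f g fg; apply: injD => i x; apply: (@hausdorffP R F) => A B nA nB.
have ev h C : nbhs (D i h x) C -> nbhs (h : W) [set k : W | C (D i k x)].
  rewrite nbhsE => -[C' [oC' C'h] C'C].
  apply: (@filterS _ _ _ [set k : W | D i k @` [set x] `<=` C']).
    by move=> k kC; apply/C'C/kC; exists x.
  apply: open_nbhs_nbhs; split; last by move=> _ [_ -> <-].
  apply: initial_lcs_open => //; exact: compact_set1.
have [h [Ah Bh]] := fg _ _ (ev _ _ nA) (ev _ _ nB).
by exists (D i h x).
Qed.

(* This factory only builds the uniform structure, so the other mixins of tvsType
   are declared separately. *)
HB.instance Definition _ := PreTopologicalLmod_isTvs.Build R W
  initial_lcs_add_continuous initial_lcs_scale_continuous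
  initial_lcs_locally_convex.
HB.instance Definition _ := PreTopologicalNmodule_isTopologicalNmodule.Build W
  initial_lcs_add_continuous.
HB.instance Definition _ := TopologicalNmodule_isTopologicalLmodule.Build R W
  initial_lcs_scale_continuous.
HB.instance Definition _ := Uniform_isTvs.Build R W initial_lcs_locally_convex.
HB.instance Definition _ := isHausdorffTvs.Build R W initial_lcs_hausdorff.

End InitialLcs.


Section DirectionalDerivative.
Context (R : realType) (E : lmodType R) (F : lcsType R).
Implicit Types (f : E -> F) (x v : E) (vs : seq E) (U : set E).

(* The library's `derive` is restricted to normed modules.  A function on a
   subset U of E is represented by a total function; all the notions below only
   depend on its values on U when U is open. *)
Definition is_dderive f v x (l : F) : Prop :=
  (t^-1 *: (f (x + t *: v) - f x)) @[t --> (0 : R)^'] --> l.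

Definition dderivable f v x : Prop := exists l, is_dderive f v x l.

Definition dderive f v x : F := xget 0 (is_dderive f v x).

(* iter_dderive [:: v1; ...; vk] f = D_{vk} ... D_{v1} f *)
Definition iter_dderive vs f : E -> F := foldl dderive f vs.

Fixpoint iter_dderivable U vs f : Prop :=
  if vs is v :: vs' then
    (forall x, U x -> dderivable f v x) /\ iter_dderivable U vs' (dderive f v)
  else True.

Lemma dderiveE f v x l : is_dderive f v x l -> dderive f v x = l.
Proof.
move=> fl; apply: xget_unique => // m fm.
exact: (@cvg_unique F (@hausdorffP R F) _ _ _ _ fm fl).
Qed.

Lemma dderivableP f v x : dderivable f v x -> is_dderive f v x (dderive f v x).
Proof. by move=> [l fl]; rewrite (dderiveE fl). Qed.

End DirectionalDerivative.

Section IteratedDerivativeLinear.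
Context (R : realType) (E : tvsType R) (F : lcsType R) (U : set E).
Hypothesis oU : open U.
Implicit Types (f g h : E -> F).

Let near_line x v : U x -> \forall t \near (0 : R)^', U (x + t *: v).
Proof.
move=> Ux; apply: cvg_within.
have c : (x + t *: v) @[t --> (0 : R)] --> x.
  rewrite -[X in _ --> X]addr0 -(scale0r v).
  apply: (@continuous2_cvg R E E E _ _ (fun=> x) (fun t : R => t *: v) +%R).
  - exact: (@add_continuous E (x, 0 *: v)).
  - exact: cvg_cst.
  - apply: (@continuous2_cvg R R^o E E _ _ id (fun=> v) *:%R).
    + exact: (@scale_continuous R E (0 : R^o, v)).
    + exact: cvg_id.
    + exact: cvg_cst.
by apply: c; apply: open_nbhs_nbhs.
Qed.

Lemma is_dderive_lin f g h v x a l m : U x ->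
  {in U, h =1 a *: f + g} -> is_dderive f v x l -> is_dderive g v x m ->
  is_dderive h v x (a *: l + m).
Proof.
move=> Ux hE fl gm; rewrite /is_dderive.
have : a *: (t^-1 *: (f (x + t *: v) - f x)) + t^-1 *: (g (x + t *: v) - g x)
    @[t --> (0 : R)^'] --> a *: l + m.
  apply: (@continuous2_cvg R F F F _ _ _ _ +%R).
  - exact: (@add_continuous F (_, _)).
  - apply: (@continuous2_cvg R R^o F F _ _ (fun=> a) _ *:%R).
    + exact: (@scale_continuous R F (a : R^o, l)).
    + exact: cvg_cst.
    + exact: fl.
  - exact: gm.
apply: cvg_trans; apply: near_eq_cvg.
apply: filterS (near_line v Ux) => t Ut.
rewrite !hE ?inE//= scalerA mulrC -scalerA -scalerDr; congr (_ *: _).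
by rewrite scalerBr opprD addrACA.
Qed.

Lemma iter_dderive_lin vs f g h a : {in U, h =1 a *: f + g} ->
  iter_dderivable U vs f -> iter_dderivable U vs g ->
  iter_dderivable U vs h /\
  {in U, iter_dderive vs h =1 a *: iter_dderive vs f + iter_dderive vs g}.
Proof.
elim: vs f g h => [|v vs IH] f g h hE //= [fv fvs] [gv gvs].
have hv x : U x -> is_dderive h v x (a *: dderive f v x + dderive g v x).
  move=> Ux; apply: (is_dderive_lin Ux hE).
    exact/dderivableP/fv.
  exact/dderivableP/gv.
have [|h1 h2] := IH (dderive f v) (dderive g v) (dderive h v) _ fvs gvs.
  by move=> x /set_mem Ux; rewrite (dderiveE (hv _ Ux)).
by split => //; split => // x /hv; eexists; eassumption.
Qed.

Lemma is_dderive0 f v x : U x -> {in U, f =1 0} -> is_dderive f v x 0.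
Proof.
move=> Ux f0; have : (fun=> 0 : F) @ (0 : R)^' --> (0 : F) by exact: cvg_cst.
apply: cvg_trans; apply: near_eq_cvg.
apply: filterS (near_line v Ux) => t Ut.
by rewrite !f0 ?inE// subr0 scaler0.
Qed.

Lemma iter_dderive0 vs f : {in U, f =1 0} ->
  iter_dderivable U vs f /\ {in U, iter_dderive vs f =1 0}.
Proof.
elim: vs f => [|v vs IH] f f0 //=.
have fv x : U x -> is_dderive f v x 0 by move=> Ux; exact: is_dderive0.
have [|h1 h2] := IH (dderive f v).
  by move=> x /set_mem Ux; rewrite (dderiveE (fv _ Ux)).
by split => //; split => // x Ux; exists 0; exact: fv.
Qed.

End IteratedDerivativeLinear.

Section ContinuousExtension.
Context (Z : topologicalType) (R : realType) (F : lcsType R).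

Definition is_cont_ext (A B : set Z) (h g : Z -> F) : Prop :=
  {within B, continuous g} /\ {in A, g =1 h}.

(* The continuous extension to B of h restricted to A: it is unique on B if A is
   dense in B; values outside of B are irrelevant. *)
Definition cont_ext (A B : set Z) (h : Z -> F) : Z -> F :=
  xget (fun=> 0) (is_cont_ext A B h).

Variables (A B : set Z).
Hypotheses (AB : A `<=` B) (BA : B `<=` closure A).

Lemma cont_ext_unique h g1 g2 :
  is_cont_ext A B h g1 -> is_cont_ext A B h g2 -> {in B, g1 =1 g2}.
Proof.
move=> [c1 e1] [c2 e2] z /set_mem Bz.
have PF : ProperFilter (within A (nbhs z)).
  by apply: within_nbhs_proper; exact: BA.
have cW (g : Z -> F) : {within B, continuous g} -> g @ within A (nbhs z) --> g z.
  move=> cg S Sz; have := iffLR (subspace_continuousP B g) cg z Bz S Sz.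
  rewrite !nbhs_simpl /within/=; apply: (@filterS _ (nbhs z)) => y.
  by move=> Sy /AB /Sy.
apply: (@cvg_unique F (@hausdorffP R F) _ _ _ _ (cW _ c1)).
apply: cvg_trans (cW _ c2); apply: near_eq_cvg.
by apply: (@nearW _ (nbhs z)) => y Ay; rewrite e1 ?e2 ?inE.
Qed.

Lemma cont_extP h : (exists g, is_cont_ext A B h g) ->
  is_cont_ext A B h (cont_ext A B h).
Proof. exact: xgetPex. Qed.

Lemma cont_extE h g : is_cont_ext A B h g -> {in B, cont_ext A B h =1 g}.
Proof. by move=> hg; apply: (cont_ext_unique _ hg); apply: cont_extP; exists g. Qed.

Lemma is_cont_ext_lin f g h f' g' a : {in A, h =1 a *: f + g} ->
  is_cont_ext A B f f' -> is_cont_ext A B g g' ->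
  is_cont_ext A B h (a *: f' + g').
Proof.
move=> hE [cf ef] [cg eg]; split; last first.
  move=> z Az; rewrite hE// -[LHS]/(a *: f' z + g' z).
  by rewrite -[RHS]/(a *: f z + g z) ef// eg.
apply/subspace_continuousP => z Bz.
apply: (@continuous2_cvg Z F F F _ _ _ _ +%R).
- exact: (@add_continuous F (_, _)).
- apply: (@continuous2_cvg Z R^o F F _ _ (fun=> a) _ *:%R).
  + exact: (@scale_continuous R F (a : R^o, _)).
  + exact: cvg_cst.
  + exact: (iffLR (subspace_continuousP B f') cf z Bz).
- exact: (iffLR (subspace_continuousP B g') cg z Bz).
Qed.

End ContinuousExtension.

Lemma continuous_comp_within (X Y Z : topologicalType) (A : set Y)
    (h : X -> Y) (g : Y -> Z) : {within A, continuous g} ->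
  continuous h -> (forall x, A (h x)) -> continuous (g \o h).
Proof.
move=> cg ch hA x S gS.
have := iffLR (subspace_continuousP A g) cg (h x) (hA x) S gS.
rewrite !nbhs_simpl /within/= => /ch; rewrite !nbhs_simpl /=.
by apply: (@filterS _ (nbhs x)) => y; apply.
Qed.

Lemma set_val_continuous (X : topologicalType) (A : set X) :
  continuous (set_val : A -> X).
Proof. exact: initial_continuous. Qed.

Lemma continuous_pair (X Y Z : topologicalType) (f : X -> Y) (g : X -> Z) :
  continuous f -> continuous g -> continuous (fun x => (f x, g x)).
Proof.
move=> cf cg x S [[S1 S2] /= [S1f S2g] S12]; rewrite nbhs_simpl /=.
apply: (@filterS _ (nbhs x) _ (f @^-1` S1 `&` g @^-1` S2)).
  by move=> y [? ?]; exact: S12.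
by apply: filterI; [exact: cf|exact: cg].
Qed.

Lemma continuous_fst (X Y : topologicalType) : continuous (@fst X Y).
Proof.
by move=> z S zS; exists (S, setT) => /=; [split => //; exact: filterT|case=> ? ? []].
Qed.

Lemma continuous_snd (X Y : topologicalType) : continuous (@snd X Y).
Proof.
by move=> z S zS; exists (setT, S) => /=; [split => //; exact: filterT|case=> ? ? []].
Qed.

Lemma continuous_comp_total (X Y Z : topologicalType) (f : X -> Y) (g : Y -> Z) :
  continuous f -> continuous g -> continuous (g \o f).
Proof. by move=> cf cg x; apply: continuous_comp; [exact: cf|exact: cg]. Qed.

Lemma set_val_pair_continuous (X Y : topologicalType) (A : set X) :
  continuous (fun z : A * Y => (set_val z.1, z.2)).
Proof.
apply: continuous_pair; last exact: continuous_snd.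
apply: (@continuous_comp_total _ _ _ fst set_val).
  exact: continuous_fst.
exact: set_val_continuous.
Qed.

Lemma set_val_pair2_continuous (X1 X2 Y : topologicalType) (A : set X1)
    (B : set X2) :
  continuous (fun z : (A * B) * Y => ((set_val z.1.1, set_val z.1.2), z.2)).
Proof.
apply: continuous_pair; last exact: continuous_snd.
apply: (@continuous_comp_total _ _ _ fst
  (fun p : A * B => (set_val p.1, set_val p.2))); first exact: continuous_fst.
apply: continuous_pair.
  apply: (@continuous_comp_total _ _ _ fst set_val).
    exact: continuous_fst.
  exact: set_val_continuous.
apply: (@continuous_comp_total _ _ _ snd set_val).
  exact: continuous_snd.
exact: set_val_continuous.
Qed.

Section IteratedDifferential.
Context (R : realType) (E : tvsType R) (F : lcsType R).
Context (P : topologicalType) (ds : P -> seq E).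
Implicit Types (A B : set E) (f g h : E -> F).

(* ds p is the sequence of directions encoded by the parameter p *)
Definition iter_diff f (z : E * P) : F := iter_dderive (ds z.2) f z.1.

Definition has_cont_iter_diff A f : Prop :=
  (forall p, iter_dderivable A (ds p) f) /\
  {within A `*` setT, continuous (iter_diff f)}.

Definition is_diff_ext A B f : (E * P -> F) -> Prop :=
  is_cont_ext (A `*` setT) (B `*` setT) (iter_diff f).

Definition diff_ext A B f : E * P -> F :=
  cont_ext (A `*` setT) (B `*` setT) (iter_diff f).

Section Linearity.
Variables (A B : set E).
Hypotheses (oA : open A) (AB : A `<=` B) (BA : B `<=` closure A).

Let AB' : A `*` [set: P] `<=` B `*` setT.
Proof. by move=> z [/AB]. Qed.

Let BA' : B `*` [set: P] `<=` closure (A `*` setT).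
Proof.
move=> [x p] [/= /BA clx _] S [[S1 S2] /= [S1x S2p] S12].
have [y [Ay Sy]] := clx _ S1x.
by exists (y, p); split => //; apply: S12; split => //=; exact: nbhs_singleton.
Qed.

Lemma iter_diff_lin f g h a : {in A, h =1 a *: f + g} ->
  (forall p, iter_dderivable A (ds p) f) ->
  (forall p, iter_dderivable A (ds p) g) ->
  {in A `*` setT, iter_diff h =1 a *: iter_diff f + iter_diff g}.
Proof.
move=> hE df dg [x p] /set_mem [/= Ax _].
have [_ /(_ x)] := iter_dderive_lin oA hE (df p) (dg p).
by rewrite inE; exact.
Qed.

Lemma has_cont_iter_diff_lin f g h a : {in A, h =1 a *: f + g} ->
  has_cont_iter_diff A f -> has_cont_iter_diff A g -> has_cont_iter_diff A h.
Proof.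
move=> hE [df cf] [dg cg]; split.
  by move=> p; have [] := iter_dderive_lin oA hE (df p) (dg p).
have [] // := @is_cont_ext_lin _ _ _ (A `*` setT) (A `*` setT)
  (iter_diff f) (iter_diff g) (iter_diff h) (iter_diff f) (iter_diff g) a.
  exact: iter_diff_lin.
have hE' := iter_diff_lin hE df dg.
move=> + _; apply: subspace_eq_continuous => z Az.
exact/esym/hE'.
Qed.

Lemma is_diff_ext_lin f g h a (f' g' : E * P -> F) : {in A, h =1 a *: f + g} ->
  has_cont_iter_diff A f -> has_cont_iter_diff A g ->
  is_diff_ext A B f f' -> is_diff_ext A B g g' ->
  is_diff_ext A B h (a *: f' + g').
Proof.
move=> hE [df _] [dg _]; apply: is_cont_ext_lin.
exact: iter_diff_lin.
Qed.

Lemma diff_ext_lin f g h a : {in A, h =1 a *: f + g} ->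
  has_cont_iter_diff A f -> has_cont_iter_diff A g ->
  (exists e, is_diff_ext A B f e) -> (exists e, is_diff_ext A B g e) ->
  forall x p, B x ->
    diff_ext A B h (x, p) = a *: diff_ext A B f (x, p) + diff_ext A B g (x, p).
Proof.
move=> hE cf cg /cont_extP ef /cont_extP eg x p Bx.
have := cont_extE AB' BA' (is_diff_ext_lin hE cf cg ef eg).
by apply; rewrite inE; split.
Qed.

Lemma iter_diff0 f : {in A, f =1 0} -> {in A `*` setT, iter_diff f =1 0}.
Proof.
move=> f0 [x p] /set_mem [/= Ax _].
have [_ /(_ x)] := iter_dderive0 oA (ds p) f0.
by rewrite inE; exact.
Qed.

Lemma has_cont_iter_diff0 f : {in A, f =1 0} -> has_cont_iter_diff A f.
Proof.
move=> f0; split; first by move=> p; have [] := iter_dderive0 oA (ds p) f0.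
have : {within A `*` setT, continuous (cst 0 : E * P -> F)}.
  by apply: continuous_subspaceT => z; exact: cvg_cst.
by apply: subspace_eq_continuous => z Az; exact/esym/(iter_diff0 f0).
Qed.

Lemma is_diff_ext0 f : {in A, f =1 0} -> is_diff_ext A B f 0.
Proof.
move=> f0; split; last by move=> z Az; rewrite (iter_diff0 f0).
by apply: continuous_subspaceT => z; exact: cvg_cst.
Qed.

Lemma diff_ext0 f x p : {in A, f =1 0} -> B x -> diff_ext A B f (x, p) = 0.
Proof.
move=> f0 Bx; have := cont_extE AB' BA' (is_diff_ext0 f0).
by apply; rewrite inE; split.
Qed.

Lemma diff_ext_continuous f : (exists e, is_diff_ext A B f e) ->
  {within B `*` setT, continuous (diff_ext A B f)}.
Proof. by move=> /cont_extP []. Qed.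

End Linearity.

End IteratedDifferential.

Section LocallyConvexSubsets.
Context (R : realType) (E : tvsType R).

Definition locally_convex_set (U : set E) : Prop :=
  forall x, U x -> exists C : set E,
    [/\ convex_set C, C `<=` U & within U (nbhs x) C].

Definition dense_interior (U : set E) : Prop := U `<=` closure U°.

End LocallyConvexSubsets.

(* None stands for infinity *)
Definition smoothness := option nat.
Definition smooth : smoothness := None.
Definition le_smoothness (k : nat) (r : smoothness) : bool :=
  if r is Some n then (k <= n)%N else true.

Section Cr.
Context (R : realType) (E F : lcsType R).
Implicit Types (U : set E) (f g h : E -> F) (k : nat) (r : smoothness).

Definition dirs k (y : {ptws 'I_k -> E}) : seq E := [seq y i | i <- enum 'I_k].

Definition Cr_open U r f : Prop :=
  forall k, le_smoothness k r -> has_cont_iter_diff (@dirs k) U f.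

(* d^(k) f, meaningful on U x E^k *)
Definition dk U k f : E * {ptws 'I_k -> E} -> F := diff_ext (@dirs k) U° U f.

Definition Cr_on U r f : Prop :=
  [/\ Cr_open U° r f,
      forall k, le_smoothness k r -> exists e, is_diff_ext (@dirs k) U° U f e
    & forall x y, U x -> @dk U 0 f (x, y) = f x].

Lemma Cr_on_lin U r f g h a : dense_interior U -> {in U, h =1 a *: f + g} ->
  Cr_on U r f -> Cr_on U r g -> Cr_on U r h.
Proof.
move=> dU hE [of_ ef f0] [og eg g0].
have oU := @open_interior _ U; have sU := @interior_subset _ U.
have hE' : {in (U° : set E), h =1 a *: f + g}.
  by move=> x /set_mem /sU Ux; apply: hE; rewrite inE.
have le0r : le_smoothness 0 r by case: r {of_ ef og eg}.
split.
- move=> k kr; apply: (has_cont_iter_diff_lin oU hE'); [exact: of_|exact: og].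
- move=> k kr; have [f' ?] := ef k kr; have [g' ?] := eg k kr.
  exists (a *: f' + g').
  exact: (is_diff_ext_lin oU hE' (of_ _ kr) (og _ kr)).
- move=> x y Ux; rewrite /dk.
  rewrite (diff_ext_lin oU sU dU hE' (of_ _ le0r) (og _ le0r) (ef _ le0r) (eg _ le0r))//.
  by rewrite [X in a *: X + _]f0// [X in _ + X]g0// hE// inE.
Qed.

Lemma Cr_on0 U r f : dense_interior U -> {in U, f =1 0} -> Cr_on U r f.
Proof.
move=> dU f0; have oU := @open_interior _ U; have sU := @interior_subset _ U.
have f0' : {in (U° : set E), f =1 0}.
  by move=> x /set_mem /sU Ux; apply: f0; rewrite inE.
split.
- by move=> k kr; exact: has_cont_iter_diff0.
- by move=> k kr; exists 0; exact: is_diff_ext0.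
- move=> x y Ux; rewrite /dk (diff_ext0 _ oU sU dU _ f0')// f0//.
  by rewrite inE.
Qed.

End Cr.

Section InteriorProduct.
Context (R : realType) (E1 E2 : lcsType R) (U : set E1) (V : set E2).

Lemma open_interiorX : open (U° `*` V°).
Proof.
rewrite openE => -[x y] [/= Ux Vy]; exists (U°, V°) => //=.
by split; apply: open_nbhs_nbhs; split => //; exact: open_interior.
Qed.

Lemma interiorX_subset : U° `*` V° `<=` U `*` V.
Proof. by move=> z [/interior_subset ? /interior_subset ?]. Qed.

Lemma dense_interiorX : dense_interior U -> dense_interior V ->
  U `*` V `<=` closure (U° `*` V°).
Proof.
move=> dU dV [x y] [/= /dU Ux /dV Vy] S [[S1 S2] /= [S1x S2y] S12].
have [x' [? ?]] := Ux _ S1x; have [y' [? ?]] := Vy _ S2y.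
by exists (x', y'); split => //; exact: S12.
Qed.

End InteriorProduct.

Section Crs.
Context (R : realType) (E1 E2 F : lcsType R).
Implicit Types (U : set E1) (V : set E2) (f g h : E1 * E2 -> F).
Implicit Types (i j : nat) (r s : smoothness).

(* D_{(w_i,0)} ... D_{(w_1,0)} D_{(0,v_j)} ... D_{(0,v_1)}: the directions in E2
   are applied first. *)
Definition dirs2 i j (wv : {ptws 'I_i -> E1} * {ptws 'I_j -> E2}) :
    seq (E1 * E2) :=
  [seq (0, v) | v <- dirs wv.2] ++ [seq (w, 0) | w <- dirs wv.1].

Definition Crs_open U V r s f : Prop :=
  forall i j, le_smoothness i r -> le_smoothness j s ->
    has_cont_iter_diff (@dirs2 i j) (U `*` V) f.

(* d^(i,j) f, meaningful on U x V x E1^i x E2^j *)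
Definition dij U V i j f :
    (E1 * E2) * ({ptws 'I_i -> E1} * {ptws 'I_j -> E2}) -> F :=
  diff_ext (@dirs2 i j) (U° `*` V°) (U `*` V) f.

Definition Crs_on U V r s f : Prop :=
  [/\ Crs_open U° V° r s f,
      forall i j, le_smoothness i r -> le_smoothness j s ->
        exists e, is_diff_ext (@dirs2 i j) (U° `*` V°) (U `*` V) f e
    & forall x y wv, U x -> V y -> @dij U V 0 0 f ((x, y), wv) = f (x, y)].

Section Linearity.
Variables (U : set E1) (V : set E2).
Hypotheses (dU : dense_interior U) (dV : dense_interior V).

Let oUV := @open_interiorX R E1 E2 U V.
Let sUV := @interiorX_subset R E1 E2 U V.
Let dUV := dense_interiorX dU dV.

Lemma Crs_on_lin r s f g h a : {in U `*` V, h =1 a *: f + g} ->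
  Crs_on U V r s f -> Crs_on U V r s g -> Crs_on U V r s h.
Proof.
move=> hE [of_ ef f0] [og eg g0].
have hE' : {in (U° `*` V° : set (E1 * E2)), h =1 a *: f + g}.
  by move=> x /set_mem /sUV Ux; apply: hE; rewrite inE.
have le0 t : le_smoothness 0 t by case: t.
split.
- move=> i j ir js.
  apply: (has_cont_iter_diff_lin oUV hE'); [exact: of_|exact: og].
- move=> i j ir js; have [f' ?] := ef i j ir js; have [g' ?] := eg i j ir js.
  exists (a *: f' + g').
  exact: (is_diff_ext_lin oUV hE' (of_ _ _ ir js) (og _ _ ir js)).
- move=> x y wv Ux Vy; rewrite /dij.
  rewrite (diff_ext_lin oUV sUV dUV hE' (of_ _ _ (le0 _) (le0 _))
    (og _ _ (le0 _) (le0 _)) (ef _ _ (le0 _) (le0 _)) (eg _ _ (le0 _) (le0 _)))//.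
  by rewrite [X in a *: X + _]f0// [X in _ + X]g0// hE// inE.
Qed.

Lemma Crs_on0 r s f : {in U `*` V, f =1 0} -> Crs_on U V r s f.
Proof.
move=> f0.
have f0' : {in (U° `*` V° : set (E1 * E2)), f =1 0}.
  by move=> x /set_mem /sUV Ux; apply: f0; rewrite inE.
split.
- by move=> i j _ _; exact: has_cont_iter_diff0.
- by move=> i j _ _; exists 0; exact: is_diff_ext0.
- move=> x y wv Ux Vy; rewrite /dij (diff_ext0 _ oUV sUV dUV _ f0')// f0//.
  by rewrite inE.
Qed.

End Linearity.

End Crs.

(* chart_map and chart_inv are only meaningful on chart_dom and chart_cod *)
Record chart (R : realType) (E : lcsType R) (M : topologicalType) := Chart {
  chart_dom : set M;
  chart_cod : set E;
  chart_map :> M -> E;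
  chart_inv : E -> M;
  chart_dom_open : open chart_dom;
  chart_cod_locally_convex : locally_convex_set chart_cod;
  chart_cod_dense_interior : dense_interior chart_cod;
  chart_map_cod : forall x, chart_dom x -> chart_cod (chart_map x);
  chart_inv_dom : forall y, chart_cod y -> chart_dom (chart_inv y);
  chart_mapK : forall x, chart_dom x -> chart_inv (chart_map x) = x;
  chart_invK : forall y, chart_cod y -> chart_map (chart_inv y) = y;
  chart_map_continuous : {within chart_dom, continuous chart_map};
  chart_inv_continuous : {within chart_cod, continuous chart_inv} }.

Definition smooth_transition (R : realType) (E : lcsType R)
    (M : topologicalType) (phi psi : chart E M) : Prop :=
  Cr_on (phi @` (chart_dom phi `&` chart_dom psi)) smooth
        (psi \o chart_inv phi).

Definition compatible (R : realType) (E : lcsType R) (M : topologicalType)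
    (phi psi : chart E M) : Prop :=
  smooth_transition phi psi /\ smooth_transition psi phi.

Record manifold (R : realType) (E : lcsType R) := Manifold {
  manifold_space :> topologicalType;
  manifold_hausdorff : hausdorff_space manifold_space;
  atlas : set (chart E manifold_space);
  atlas_cover : forall x, exists2 phi, atlas phi & chart_dom phi x;
  atlas_compatible : forall phi psi,
    atlas phi -> atlas psi -> compatible phi psi }.

Definition maximal_atlas (R : realType) (E : lcsType R) (M : manifold E) :
    set (chart E M) :=
  [set phi | forall psi, atlas psi -> compatible phi psi].

Lemma maximal_atlas_cover (R : realType) (E : lcsType R) (M : manifold E)
  (x : M) : exists2 phi, maximal_atlas phi & chart_dom phi x.
Proof.
have [phi aphi phix] := atlas_cover x.
by exists phi => // psi; exact: atlas_compatible.
Qed.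

Section CrSpace.
Context (R : realType) (E : lcsType R) (r : smoothness) (M : manifold E).
Context (F : lcsType R).

Definition is_Cr (f : M -> F) : Prop :=
  forall phi : chart E M, maximal_atlas phi ->
    Cr_on (chart_cod phi) r (f \o chart_inv phi).

Definition Cr_pred : {pred M -> F} := [pred f | `[< is_Cr f >]].

Record Cr : Type := MkCr { Cr_fun :> M -> F; Cr_funP : Cr_fun \in Cr_pred }.

HB.instance Definition _ := [isSub for Cr_fun].
HB.instance Definition _ := [Choice of Cr by <:].

Lemma Cr_submod_closed : submod_closed Cr_pred.
Proof.
split.
  apply: asboolT => phi _.
  by apply: Cr_on0 => //; exact: chart_cod_dense_interior.
move=> a f g /asboolP fr /asboolP gr; apply: asboolT => phi aphi.
apply: (@Cr_on_lin _ _ _ _ _ (f \o chart_inv phi) (g \o chart_inv phi) _ a) => //.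
- exact: chart_cod_dense_interior.
- exact: fr.
- exact: gr.
Qed.

HB.instance Definition _ := GRing.isSubmodClosed.Build _ _ Cr_pred
  Cr_submod_closed.
HB.instance Definition _ := [SubChoice_isSubLmodule of Cr by <:].

Lemma CrP (f : Cr) : is_Cr f.
Proof. exact: (asboolW (Cr_funP f)). Qed.

(* The initial topologies along f |-> f o phi^-1 and along d^(k) are merged into a
   single one, with respect to the maps f |-> d^(k) (f o phi^-1) into
   C(V_phi x E^k, F). *)
Definition Cr_index : Type :=
  ({phi : chart E M | maximal_atlas phi} * {k : nat | le_smoothness k r})%type.

Definition Cr_op_dom (i : Cr_index) : topologicalType :=
  ((chart_cod (sval i.1) : set E) * {ptws 'I_(sval i.2) -> E})%type.

Definition Cr_op (i : Cr_index) (f : Cr) (z : Cr_op_dom i) : F :=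
  @dk R E F (chart_cod (sval i.1)) (sval i.2) (f \o chart_inv (sval i.1))
    (set_val z.1, z.2).

Lemma Cr_op_linear : ops_linear Cr_op.
Proof.
move=> [[phi aphi] [k kr]] a f g [x y]; rewrite /Cr_op /dk /=.
have [f1 f2 _] := CrP f aphi; have [g1 g2 _] := CrP g aphi.
apply: (@diff_ext_lin _ _ _ _ _ _ _ _ _ _
  (f \o chart_inv phi) (g \o chart_inv phi)) => //.
- exact: open_interior.
- exact: interior_subset.
- exact: chart_cod_dense_interior.
- exact: f1.
- exact: g1.
- exact: f2.
- exact: g2.
- exact: set_valP.
Qed.

Lemma Cr_op_continuous : ops_continuous Cr_op.
Proof.
move=> [[phi aphi] [k kr]] f.
have [_ f2 _] := CrP f aphi.
apply: (continuous_comp_within (diff_ext_continuous (f2 _ kr))).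
  exact: set_val_pair_continuous.
by move=> [x y]; split => //; exact: set_valP.
Qed.

Lemma Cr_op_injective : ops_injective Cr_op.
Proof.
move=> f g fg; apply/val_inj/funext => x.
have [phi aphi phix] := maximal_atlas_cover x.
have le0 : le_smoothness 0 r by case: (r).
have cx := chart_map_cod phix.
have := fg (exist _ phi aphi, exist (le_smoothness^~ r) 0%N le0)
  (exist _ (phi x) (mem_set cx), fun=> 0).
have [_ _ f3] := CrP f aphi; have [_ _ g3] := CrP g aphi.
by rewrite /Cr_op /set_val /= [X in X = _]f3// [X in _ = X]g3//= chart_mapK.
Qed.

HB.instance Definition _ := LocallyConvexSpace.copy Cr
  (initial_lcs Cr_op_linear Cr_op_continuous Cr_op_injective).

End CrSpace.
Section CrsSpace.
Context (R : realType) (E1 E2 : lcsType R) (r s : smoothness).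
Context (M1 : manifold E1) (M2 : manifold E2) (F : lcsType R).

Definition chart_inv2 (phi : chart E1 M1) (psi : chart E2 M2)
  (p : E1 * E2) : M1 * M2 := (chart_inv phi p.1, chart_inv psi p.2).

Definition is_Crs (f : M1 * M2 -> F) : Prop :=
  forall (phi : chart E1 M1) (psi : chart E2 M2),
    maximal_atlas phi -> maximal_atlas psi ->
    Crs_on (chart_cod phi) (chart_cod psi) r s (f \o chart_inv2 phi psi).

Definition Crs_pred : {pred M1 * M2 -> F} := [pred f | `[< is_Crs f >]].

Record Crs : Type := MkCrs {
  Crs_fun :> M1 * M2 -> F;
  Crs_funP : Crs_fun \in Crs_pred }.

HB.instance Definition _ := [isSub for Crs_fun].
HB.instance Definition _ := [Choice of Crs by <:].

Lemma Crs_submod_closed : submod_closed Crs_pred.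
Proof.
split.
  by apply: asboolT => phi psi _ _;
     apply: Crs_on0 => //; exact: chart_cod_dense_interior.
move=> a f g /asboolP fr /asboolP gr; apply: asboolT => phi psi aphi apsi.
apply: (@Crs_on_lin _ _ _ _ _ _ _ _ _ _ (f \o chart_inv2 phi psi)
  (g \o chart_inv2 phi psi) _ a) => //.
- exact: chart_cod_dense_interior.
- exact: chart_cod_dense_interior.
- exact: fr.
- exact: gr.
Qed.

HB.instance Definition _ := GRing.isSubmodClosed.Build _ _ Crs_pred
  Crs_submod_closed.
HB.instance Definition _ := [SubChoice_isSubLmodule of Crs by <:].

Lemma CrsP (f : Crs) : is_Crs f.
Proof. exact: (asboolW (Crs_funP f)). Qed.

Definition Crs_index : Type :=
  (({phi : chart E1 M1 | maximal_atlas phi} *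
    {psi : chart E2 M2 | maximal_atlas psi}) *
   ({i : nat | le_smoothness i r} * {j : nat | le_smoothness j s}))%type.

Definition Crs_op_dom (a : Crs_index) : topologicalType :=
  (((chart_cod (sval a.1.1) : set E1) * (chart_cod (sval a.1.2) : set E2)) *
   ({ptws 'I_(sval a.2.1) -> E1} * {ptws 'I_(sval a.2.2) -> E2}))%type.

Definition Crs_op (a : Crs_index) (f : Crs) (z : Crs_op_dom a) : F :=
  @dij R E1 E2 F (chart_cod (sval a.1.1)) (chart_cod (sval a.1.2))
    (sval a.2.1) (sval a.2.2) (f \o chart_inv2 (sval a.1.1) (sval a.1.2))
    ((set_val z.1.1, set_val z.1.2), z.2).

Lemma Crs_op_linear : ops_linear Crs_op.
Proof.
move=> [[[phi aphi] [psi apsi]] [[i ir] [j js]]] a f g [[x y] wv].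
rewrite /Crs_op /dij /=.
have [f1 f2 _] := CrsP f aphi apsi; have [g1 g2 _] := CrsP g aphi apsi.
have dphi := @chart_cod_dense_interior _ _ _ phi.
have dpsi := @chart_cod_dense_interior _ _ _ psi.
apply: (@diff_ext_lin _ _ _ _ _ _ _ _ _ _
  (f \o chart_inv2 phi psi) (g \o chart_inv2 phi psi)) => //.
- exact: open_interiorX.
- exact: interiorX_subset.
- exact: dense_interiorX.
- exact: f1.
- exact: g1.
- exact: f2.
- exact: g2.
- by split; exact: set_valP.
Qed.

Lemma Crs_op_continuous : ops_continuous Crs_op.
Proof.
move=> [[[phi aphi] [psi apsi]] [[i ir] [j js]]] f.
have [_ f2 _] := CrsP f aphi apsi.
apply: (continuous_comp_within (diff_ext_continuous (f2 _ _ ir js))).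
  exact: set_val_pair2_continuous.
by move=> [[x y] wv]; split => //; split; exact: set_valP.
Qed.

Lemma Crs_op_injective : ops_injective Crs_op.
Proof.
move=> f g fg; apply/val_inj/funext => -[x y].
have [phi aphi phix] := maximal_atlas_cover x.
have [psi apsi psiy] := maximal_atlas_cover y.
have le0 t : le_smoothness 0 t by case: t.
have cx := chart_map_cod phix; have cy := chart_map_cod psiy.
have := fg ((exist _ phi aphi, exist _ psi apsi),
            (exist (le_smoothness^~ r) 0%N (le0 r),
             exist (le_smoothness^~ s) 0%N (le0 s)))
  ((exist _ (phi x) (mem_set cx), exist _ (psi y) (mem_set cy)),
   (fun=> 0, fun=> 0)).
have [_ _ f3] := CrsP f aphi apsi; have [_ _ g3] := CrsP g aphi apsi.
rewrite /Crs_op /set_val /= [X in X = _]f3// [X in _ = X]g3//=.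
by rewrite /chart_inv2/= !chart_mapK.
Qed.

HB.instance Definition _ := LocallyConvexSpace.copy Crs
  (initial_lcs Crs_op_linear Crs_op_continuous Crs_op_injective).

End CrsSpace.

(* Main.v *)
Require Import Defs.
From HB Require Import structures.
From mathcomp Require Import all_boot all_order all_algebra.
From mathcomp Require Import interval_inference all_classical all_reals topology
  convex normedtype.

Set Implicit Arguments.
Unset Strict Implicit.
Unset Printing Implicit Defensive.

Import Order.TTheory GRing.Theory Num.Theory.
Import numFieldNormedType.Exports.

Local Open Scope classical_set_scope.
Local Open Scope ring_scope.

(** Write f^v for the curried form of a map f on M1 x M2.  In a pair of charts with
   ranges U and V, both sides of the isomorphism are governed by the same functions
   e_ij of (x, y, w_1 .. w_i, v_1 .. v_j): on the left e_ij is the (i, j)-th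
   derivative of f, on the right it is the j-th derivative of the element of
   C^s(M2, F) which is the i-th derivative of f^v.  A family of continuous functions
   which satisfies the expected differential equations at interior points consists
   of the iterated derivatives of its member of order 0; such families are called
   jets here (Cr_jet_on, Crs_jet_on), and the proof transports them from one side to
   the other.

   Currying.  By definition f has derivatives in direction w of its iterated
   derivatives in directions v, at interior points of U x V.  Two things more are
   needed: f(x, -) and the higher derivatives at x must lie in C^s for every x, be it
   a boundary point, which asks for v-derivatives of all the e_ij; and the
   w-derivatives must be limits of difference quotients in the topology of
   C^s(M2, F), hence uniformly on compact subsets of V x E2^j.  Both rest on
   mean_value_cvg: if the derivatives of a family of curves converge jointly in the
   parameter and in time, then so do the difference quotients.  It follows from a
   mean value theorem for convex sets, which takes the place of integration in F.
   Its consequences are the passage to the boundary (is_dderive_closure) and the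
   theorem of Schwarz (schwarz), which yield the equations Crs_jet_dV and Crs_jet_dU,
   and then curry_jet.

   Uncurrying.  If g : M1 -> C^s(M2, F) is C^r, then the functions e_ij built from g
   satisfy the right equations because evaluation at a point is linear and
   continuous on C^s(M2, F).  What has to be shown is that e_ij is jointly
   continuous.  On compact sets it always is, since evaluation is continuous on
   C(K, F) x K for compact K (dk_eval_cvg).  That is enough if the space is a k-space
   (k_space_within_continuous), and also if M2 is locally compact, because then V and
   the space E2 are (chart_compact_nbhs, model_compact_nbhs).  The k-space hypotheses
   involve at most one copy of each of E1 and E2, while e_ij depends on i + j
   directions; polarization closes this gap: iterated derivatives are symmetric and additive in
   the directions, hence linear combinations of their values on tuples of equal
   directions (dk_polarization, uncurry_dij_continuous).

   Topologies.  Both topologies are initial for the same operators f |-> e_ij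
   (Cr_op_curry), seen as maps into C(K x L, F) on one side and into C(K, C(L, F)) on
   the other, so the continuity of Phi and of its inverse is again a matter of
   evaluating on compact sets (curry_continuous, uncurry_continuous). *)

(** * Limits in locally convex spaces *)

Section TvsLimits.
Context (R : realType) (E : tvsType R).

Lemma tvs_cvgD (T : Type) (G : set_system T) {FG : Filter G} (f g : T -> E)
    (a b : E) :
  f @ G --> a -> g @ G --> b -> (f x + g x) @[x --> G] --> a + b.
Proof.
move=> fa gb; apply: (@continuous2_cvg _ _ _ _ _ _ _ _ +%R) => //.
exact: (@add_continuous E (_, _)).
Qed.

Lemma tvs_cvgZ (T : Type) (G : set_system T) {FG : Filter G} (c : T -> R)
    (f : T -> E) (t : R) (a : E) :
  c @ G --> t -> f @ G --> a -> (c x *: f x) @[x --> G] --> t *: a.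
Proof.
move=> ct fa.
apply: (@continuous2_cvg _ (R^o) E E _ _ c f *:%R) => //.
exact: (@scale_continuous R E (t : R^o, a)).
Qed.

Lemma tvs_cvgB (T : Type) (G : set_system T) {FG : Filter G} (f g : T -> E)
    (a b : E) :
  f @ G --> a -> g @ G --> b -> (f x - g x) @[x --> G] --> a - b.
Proof.
move=> fa gb; apply: tvs_cvgD => //.
apply: (@cvg_comp _ _ _ g -%R G (nbhs b)) => //.
exact: opp_continuous.
Qed.

Lemma line_cvg (T : Type) (G : set_system T) {FG : Filter G} (f : T -> E)
    (c : T -> R) (x : E) (t : R) v :
  f @ G --> x -> c @ G --> t ->
  (f q + c q *: v) @[q --> G] --> x + t *: v.
Proof.
by move=> fx ct; apply: tvs_cvgD => //; apply: tvs_cvgZ => //; exact: cvg_cst.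
Qed.

Lemma convex_nbhs (x : E) (A : set E) : nbhs x A ->
  exists O : set E, [/\ convex_set O, open O, O x & O `<=` A].
Proof.
have [B Bc [Bo Bb]] := @locally_convex R E.
move=> /Bb[O [BO Ox] OA]; exists O; split => //.
- by apply: Bc; rewrite inE.
- exact: Bo.
Qed.

Lemma convex_combination (A : set E) (x y : E) (s t : R) : convex_set A ->
  0 <= s -> 0 <= t -> s + t = 1 -> A x -> A y -> A (s *: x + t *: y).
Proof.
move=> cA s0 t0 st Ax Ay.
have s1 : s <= 1 by rewrite -st lerDl.
pose l : {i01 R} := Itv01 s0 s1.
have := cA x y l (mem_set Ax) (mem_set Ay); rewrite inE.
have <- : 1 - s = t by rewrite -st addrC addKr.
by [].
Qed.

End TvsLimits.

(** * Mean value estimates *)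

Section MeanValue.
Context (R : realType) (F : lcsType R).

(** Curves are functions on R^o, and their derivatives are directional derivatives
   in direction 1; this turns a derivative along a line into that of a curve. *)
Lemma is_dderive_line (E : lmodType R) (f : E -> F) v x (s : R) l :
  is_dderive f v (x + s *: v) l <->
  is_dderive (fun t : R^o => f (x + t *: v)) 1 s l.
Proof.
rewrite /is_dderive.
suff -> : (fun t : R => t^-1 *: (f (x + s *: v + t *: v) - f (x + s *: v))) =
  (fun t : R => t^-1 *: (f (x + (s + t *: (1 : R^o)) *: v) - f (x + s *: v))) by [].
by apply/funext => t; rewrite -addrA -scalerDl [t *: 1]mulr1.
Qed.

(** The relation that the difference quotient over [x, y] lies in O is transitive,
   as quotients over adjacent intervals average, and it holds on small intervals
   around each point because O is a neighbourhood of the derivative there; so it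
   extends to [a, b] by completeness of R. *)
Lemma mean_value (c c' : R^o -> F) (O : set F) (a b : R) : a < b ->
  convex_set O ->
  (forall t, a <= t <= b -> is_dderive c 1 t (c' t) /\ nbhs (c' t) O) ->
  O ((b - a)^-1 *: (c b - c a)).
Proof.
move=> ab cO dc.
pose P x y := O ((y - x)^-1 *: (c y - c x)).
have Ptrans x y z : x < y -> y < z -> P x y -> P y z -> P x z.
  move=> xy yz Pxy Pyz.
  have xy0 : 0 < y - x by rewrite subr_gt0.
  have yz0 : 0 < z - y by rewrite subr_gt0.
  have xz0 : 0 < z - x by rewrite subr_gt0 (lt_trans xy).
  have := @convex_combination R F O _ _ ((y - x) / (z - x)) ((z - y) / (z - x))
    cO _ _ _ Pxy Pyz.
  rewrite !scalerA ![_ / (z - x) * _]mulrAC !mulfV ?gt_eqF// mul1r -scalerDr.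
  rewrite [_ - c x + _]addrC subrKA; apply.
  - by rewrite divr_ge0 ?ltW.
  - by rewrite divr_ge0 ?ltW.
  - by rewrite -mulrDl [_ + (z - y)]addrC subrKA mulfV ?gt_eqF.
have Ploc t : a <= t <= b -> exists2 e, 0 < e &
    (forall s, t < s -> s < t + e -> P t s) /\
    (forall s, s < t -> t - e < s -> P s t).
  move=> /dc [ct nO]; have := ct _ nO.
  rewrite /dnbhs /within /= => /nbhs_ballP [e e0 eP]; exists e => //; split.
  - move=> s ts se; have := eP (s - t); rewrite /ball /= sub0r normrN.
    rewrite gtr0_norm ?subr_gt0// ltrBlDl se subr_eq0 gt_eqF// => /(_ isT isT).
    by rewrite [_ *: (1 : R^o)]mulr1 [t + _]addrC subrK.
  - move=> s st se; have := eP (s - t); rewrite /ball /= sub0r normrN.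
    rewrite ltr0_norm ?subr_lt0// opprB ltrBlDl -ltrBlDr se subr_eq0 lt_eqF//.
    move=> /(_ isT isT).
    by rewrite [_ *: (1 : R^o)]mulr1 [t + _]addrC subrK -[s - t]opprB invrN scaleNr
      -scalerN opprB.
pose A := [set t | a < t <= b /\ P a t].
have [ea ea0 [Pa _]] := Ploc a (introT andP (conj (lexx a) (ltW ab))).
have nxt t e : t < b -> 0 < e -> exists2 s, t < s <= b & s < t + e.
  move=> tb e0; exists (Num.min b (t + e / 2)).
    by rewrite lt_min tb ltrDl divr_gt0//= ge_min lexx.
  by rewrite gt_min ltrD2l ltr_pdivrMr// ltr_pMr// ltr1n orbT.
have A0 : A !=set0.
  have [s /andP[as_ sb] se] := nxt a ea ab ea0.
  by exists s; split; [rewrite as_|exact: Pa].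
have ubA : ubound A b by move=> t [/andP[]].
have hA : has_sup A by split => //; exists b.
set s := sup A.
have sb : s <= b by apply: sup_le_ub.
have sgea : a < s.
  have [t At] := A0; have [/andP[at_ _] _] := At.
  by apply: (lt_le_trans at_); apply: (sup_upper_bound hA).
have [e e0 [Pr Pl]] := Ploc s (introT andP (conj (ltW sgea) sb)).
have Pas : P a s.
  have [t At ts] := sup_adherent e0 hA; have [/andP[at_ tb] Pat] := At.
  have := sup_upper_bound hA At; rewrite -/s le_eqVlt => /orP[/eqP <- //|ts'].
  by apply: (Ptrans _ t) => //; exact: Pl.
move: sb; rewrite le_eqVlt => /orP[/eqP <- //|sb].
have [u /andP[su ub] ue] := nxt s e sb e0.
have : A u.
  by split; [rewrite (lt_trans sgea)|apply: (Ptrans _ s) => //; exact: Pr].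
by move/(sup_upper_bound hA); rewrite leNgt su.
Qed.

(** A convex neighbourhood O of l contains the derivatives for q near G and for
   small s, hence by the mean value theorem the difference quotients too, with
   bounds that do not depend on q. *)
Lemma mean_value_cvg (Q : Type) (G : set_system Q) {FG : Filter G}
    (h h' : Q -> R^o -> F) (l : F) :
  (\forall q \near G & s \near (0 : R), is_dderive (h q) 1 s (h' q s)) ->
  h' z.1 z.2 @[z --> filter_prod G (nbhs (0 : R))] --> l ->
  (z.2^-1 *: (h z.1 z.2 - h z.1 0)) @[z --> filter_prod G ((0 : R)^')] --> l.
Proof.
move=> dh h'l A /convex_nbhs [O [cO oO Ol OA]].
have /h'l : nbhs l O by exact: open_nbhs_nbhs.
move=> /(filterI dh) [[S T] [/= GS /nbhs_ballP [e /= e0 eT]] STO].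
exists (S, [set t | `|t| < e /\ t != 0]); first split => //=.
  rewrite /dnbhs /within /=; apply/nbhs_ballP; exists e => //= t.
  by rewrite /ball /= sub0r normrN.
move=> [q t] /= [Sq [te t0]]; apply: OA.
have D s : `|s| < e -> is_dderive (h q) 1 s (h' q s) /\ nbhs (h' q s) O.
  move=> se; have [|] := STO (q, s).
    by split => //=; apply: eT; rewrite /ball /= sub0r normrN.
  by split => //; apply: open_nbhs_nbhs.
have [tgt|tlt|/eqP] := ltgtP 0 t; last by rewrite eq_sym (negPf t0).
  have := @mean_value (h q) (h' q) O 0 t tgt cO; rewrite subr0; apply.
  move=> s /andP[s0 st]; apply: D; rewrite ger0_norm//.
  by apply: le_lt_trans te; rewrite gtr0_norm.
have := @mean_value (h q) (h' q) O t 0 tlt cO.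
rewrite sub0r invrN scaleNr -scalerN opprB; apply.
move=> s /andP[ts s0]; apply: D; rewrite ler0_norm//.
by apply: le_lt_trans te; rewrite ltr0_norm// lerN2.
Qed.

(** Differentiation under a limit.  The difference quotients of H are limits of
   those of the h q, which mean_value_cvg keeps in a prescribed closed neighbourhood
   of l. *)
Lemma limit_is_dderive (Q : Type) (G : set_system Q) {PG : ProperFilter G}
    (h h' : Q -> R^o -> F)    (H : R^o -> F) (l : F) :
  (\forall q \near G & s \near (0 : R), is_dderive (h q) 1 s (h' q s)) ->
  h' z.1 z.2 @[z --> filter_prod G (nbhs (0 : R))] --> l ->
  (\forall t \near (0 : R), h q t @[q --> G] --> H t) ->
  is_dderive H 1 0 l.
Proof.
move=> dh h'l hH A nA.
have [B nB BA] := uniform_regular nA.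
have [[S T] [/= GS T0] STB] := mean_value_cvg dh h'l nB.
have hH0 := nbhs_singleton hH.
have : (0 : R)^' (T `&` [set t | h q t @[q --> G] --> H t]).
  apply: (@filterI _ (0 : R)^') => //.
  by apply: (@filterS _ (nbhs (0 : R)) _ _ _ _ hH).
apply: filterS => t [Tt hHt]; apply: BA.
rewrite /= add0r [t *: (1 : R^o)]mulr1.
have hq : t^-1 *: (h q t - h q 0) @[q --> G] --> t^-1 *: (H t - H 0).
  apply: (@tvs_cvgZ _ _ _ _ _ (fun=> t^-1)); first exact: cvg_cst.
  exact: tvs_cvgB.
move=> C nC; have : G (S `&` [set q | C (t^-1 *: (h q t - h q 0))]).
  by apply: filterI => //; exact: hq.
move=> /filter_ex [q [Sq Cq]]; exists (t^-1 *: (h q t - h q 0)).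
by split => //; exact: (STB (q, t)).
Qed.

End MeanValue.

(** * Directional derivatives: limits, additivity, symmetry *)

Lemma near_dnbhs (T : topologicalType) (x : T) (P : set T) :
  (\forall y \near x, P y) -> x^' P.
Proof. by apply: (@filterS _ (nbhs x)) => y Py _. Qed.

Section DirectionalDerivativeTheory.
Context (R : realType) (E : tvsType R) (F : lcsType R).
Implicit Types (f g : E -> F) (A B : set E).

Lemma line_continuous (x v w : E) :
  x + z.1 *: v + z.2 *: w @[z --> filter_prod (nbhs (0 : R)) (nbhs (0 : R))] --> x.
Proof.
rewrite -[X in _ --> X](addr0 x) -[X in _ + X](scale0r w).
apply: line_cvg; last exact: cvg_snd.
rewrite -[X in _ --> X](addr0 x) -[X in _ + X](scale0r v).
by apply: line_cvg; [exact: cvg_cst|exact: cvg_fst].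
Qed.

Lemma line_near A (x v w : E) : open A -> A x ->
  \forall s \near (0 : R) & t \near (0 : R), A (x + s *: v + t *: w).
Proof. by move=> oA Ax; apply: (line_continuous v w); apply: open_nbhs_nbhs. Qed.

Lemma line_near1 A (x v : E) : open A -> A x ->
  \forall q \near x & t \near (0 : R), A (q + t *: v).
Proof.
move=> oA Ax.
have : q.1 + q.2 *: v @[q --> filter_prod (nbhs x) (nbhs (0 : R))] --> x.
  rewrite -[X in _ --> X](addr0 x) -[X in _ + X](scale0r v).
  by apply: line_cvg; [exact: cvg_fst|exact: cvg_snd].
by apply; exact: open_nbhs_nbhs.
Qed.

Lemma line_near0 A (x v : E) : open A -> A x ->
  \forall t \near (0 : R), A (x + t *: v).
Proof.
move=> oA Ax; have [[S T] [/= Sx T0] H] := line_near1 v oA Ax.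
apply: filterS T0 => t Tt; apply: (H (x, t)).
by split => //=; exact: nbhs_singleton.
Qed.

Lemma is_dderive_near f g v x l : (\forall y \near x, f y = g y) ->
  is_dderive f v x l -> is_dderive g v x l.
Proof.
move=> fg; apply: cvg_trans; apply: near_eq_cvg.
have : nbhs x [set y | f y = g y] by exact: fg.
rewrite nbhsE => -[A [oA Ax] {}fg].
have An : (0 : R)^' [set t | A (x + t *: v)].
  exact/near_dnbhs/(line_near0 v oA Ax).
apply: filterS An => t At.
by rewrite fg// fg.
Qed.

(** Serves to pass from the interior A of a domain B to boundary points z, in the
   directions v along which z can be moved inside B: the curve t |-> f (z + t v) is
   the limit of the curves t |-> f (q + t v) with q in A. *)
Lemma is_dderive_closure A B f f' v z : A `<=` B -> closure A z -> B z ->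
  (\forall t \near (0 : R), B (z + t *: v)) ->
  (\forall q \near within A (nbhs z) & t \near (0 : R), A (q + t *: v)) ->
  {within B, continuous f} -> {within B, continuous f'} ->
  (forall q, A q -> is_dderive f v q (f' q)) -> is_dderive f v z (f' z).
Proof.
move=> AB clz Bz Bzt Aqt cf cf' ff'.
have PG : ProperFilter (within A (nbhs z)) by exact: within_nbhs_proper.
have qz : id @ within A (nbhs z) --> z by exact: cvg_within.
rewrite -[z in is_dderive _ _ z](addr0 z) -[X in _ + X](scale0r v).
apply/is_dderive_line.
apply: (@limit_is_dderive R F E (within A (nbhs z)) _
  (fun q t => f (q + t *: v)) (fun q t => f' (q + t *: v))).
- apply: filterS Aqt => -[q t] /= Aqt; apply/is_dderive_line; exact: ff'.
- have : q.1 + q.2 *: v @[q --> filter_prod (within A (nbhs z)) (nbhs (0 : R))]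
      --> within B (nbhs z).
    move=> S nS.
    have : q.1 + q.2 *: v
        @[q --> filter_prod (within A (nbhs z)) (nbhs (0 : R))] --> z.
      rewrite -[X in _ --> X](addr0 z) -[X in _ + X](scale0r v).
      apply: line_cvg; last exact: cvg_snd.
      exact: (cvg_comp _ _ cvg_fst qz).
    move=> /(_ _ nS) H.
    pose G := filter_prod (within A (nbhs z)) (nbhs (0 : R)).
    apply: (@filterS _ G _ _ _ _ (@filterI _ G _ _ _ H Aqt)) => -[q t] /= [+ Aq].
    by apply; exact: AB.
  move=> H; have := iffLR (subspace_continuousP B f') cf' z Bz.
  exact: cvg_comp.
- have [[S T] [/= zS T0] ST] := Aqt.
  apply: filterS (filterI Bzt T0) => t [Bt Tt].
  have := iffLR (subspace_continuousP B f) cf _ Bt; apply: cvg_comp.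
  have qt : q + t *: v @[q --> within A (nbhs z)] --> z + t *: v.
    by apply: tvs_cvgD => //; exact: cvg_cst.
  move=> N /qt nN; pose G := within A (nbhs z).
  apply: (@filterS _ G _ _ _ _ (@filterI _ G _ _ _ nN zS)) => q [/= + Sq].
  apply; apply: AB.
  exact: (ST (q, t)).
Qed.

Lemma is_dderiveZB (T : lmodType R) (g1 g2 : T -> F) v x (c : R) l1 l2 :
  is_dderive g1 v x l1 -> is_dderive g2 v x l2 ->
  is_dderive (fun y => c *: (g1 y - g2 y)) v x (c *: (l1 - l2)).
Proof.
move=> d1 d2; rewrite /is_dderive.
have H : c *: (t^-1 *: (g1 (x + t *: v) - g1 x) - t^-1 *: (g2 (x + t *: v) - g2 x))
    @[t --> (0 : R)^'] --> c *: (l1 - l2).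
  apply: (@tvs_cvgZ _ _ _ _ _ (fun=> c)); first exact: cvg_cst.
  exact: tvs_cvgB.
apply: cvg_trans H; apply: near_eq_cvg; apply: nearW => t.
rewrite -scalerBr scalerA mulrC -scalerA -scalerBr; congr (_ *: (_ *: _)).
by rewrite !opprB addrACA [in RHS]addrACA; congr (_ + _); rewrite addrC.
Qed.

(** The theorem of Schwarz, in the strong form where the second mixed derivative is
   not assumed to exist: the difference quotients of f in direction w converge to
   fw, and their derivatives in direction v are difference quotients of fv, which
   converge to fvw jointly by mean_value_cvg; so fw can be differentiated as a
   limit. *)
Lemma schwarz A f fv fw fvw v w x : open A -> A x ->
  (forall z, A z -> is_dderive f v z (fv z)) ->
  (forall z, A z -> is_dderive f w z (fw z)) ->
  (forall z, A z -> is_dderive fv w z (fvw z)) ->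
  {for x, continuous fvw} -> is_dderive fw v x (fvw x).
Proof.
move=> oA Ax dv dw dvw cvw.
rewrite -[x in is_dderive _ _ x](addr0 x) -[X in _ + X](scale0r v).
apply/is_dderive_line.
have Anear := line_near v w oA Ax.
apply: (@limit_is_dderive R F R ((0 : R)^') _
  (fun t s => t^-1 *: (f (x + s *: v + t *: w) - f (x + s *: v)))
  (fun t s => t^-1 *: (fv (x + s *: v + t *: w) - fv (x + s *: v)))).
- have [[S T] [/= S0 T0] ST] := Anear.
  exists (T, S); first by split => //=; exact: near_dnbhs.
  move=> [t s] /= [Tt Ss]; apply: is_dderiveZB.
    have -> : (fun y : R^o => f (x + y *: v + t *: w)) =
        (fun y : R^o => f (x + t *: w + y *: v)).
      by apply/funext => y; rewrite addrAC.
    apply/is_dderive_line; rewrite addrAC; apply: dv.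
    exact: (ST (s, t)).
  apply/is_dderive_line; apply: dv.
  have := ST (s, 0); rewrite /= scale0r addr0; apply; split => //=.
  exact: nbhs_singleton.
- have := @mean_value_cvg R F R (nbhs (0 : R)) _
    (fun s t => fv (x + s *: v + t *: w)) (fun s t => fvw (x + s *: v + t *: w))
    (fvw x).
  move=> /(_ _ _) H.
  have {}H : z.2^-1 *: (fv (x + z.1 *: v + z.2 *: w) - fv (x + z.1 *: v + 0 *: w))
      @[z --> filter_prod (nbhs (0 : R)) (0 : R)^'] --> fvw x.
    apply: H.
      apply: filterS Anear => -[s t] /= Ast; apply/is_dderive_line; exact: dvw.
    exact: (cvg_comp _ _ (@line_continuous x v w) cvw).
  move=> N /H [[S T] [/= S0 T0] ST]; exists (T, S) => //= -[t s] [/= Tt Ss].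
  by have := ST (s, t) (conj Ss Tt); rewrite /= scale0r addr0.
- have := line_near0 v oA Ax; apply: filterS => s As.
  exact: dw.
Qed.

(** Moving along v + w is moving along v, then along w from a point that depends on
   the step; mean_value_cvg controls the second move. *)
Lemma is_dderiveD A f fw v w x l : open A -> A x ->
  is_dderive f v x l -> (forall z, A z -> is_dderive f w z (fw z)) ->
  {for x, continuous fw} -> is_dderive f (v + w) x (l + fw x).
Proof.
move=> oA Ax dv dw cw; rewrite /is_dderive.
have Anear := line_near v w oA Ax.
have H1 : z.2^-1 *: (f (x + z.1 *: v + z.2 *: w) - f (x + z.1 *: v + 0 *: w))
    @[z --> filter_prod (nbhs (0 : R)) (0 : R)^'] --> fw x.
  apply: (@mean_value_cvg R F R (nbhs (0 : R)) _
    (fun s t => f (x + s *: v + t *: w)) (fun s t => fw (x + s *: v + t *: w))).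
    apply: filterS Anear => -[s t] /= Ast; apply/is_dderive_line; exact: dw.
  exact: (cvg_comp _ _ (@line_continuous x v w) cw).
have dg : (t, t) @[t --> (0 : R)^'] --> filter_prod (nbhs (0 : R)) (0 : R)^'.
  move=> N [[S T] [/= S0 T0] ST]; pose G := (0 : R)^'.
  apply: (@filterS _ G _ _ _ _ (@filterI _ G _ _ _ (near_dnbhs S0) T0)).
  by move=> t [St Tt]; exact: (ST (t, t)).
have H2 := cvg_comp _ _ dg H1.
apply: cvg_trans (tvs_cvgD dv H2); apply: near_eq_cvg; apply: nearW => t /=.
rewrite -scalerDr scale0r addr0 [t *: (v + w)]scalerDr [x + (t *: v + _)]addrA.
congr (_ *: _).
by rewrite [LHS]addrC subrKA.
Qed.

End DirectionalDerivativeTheory.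

(** * Jets: differentiability through families of candidate derivatives *)

Lemma within_continuous_comp (X Y Z : topologicalType) (A : set X) (B : set Y)
    (h : X -> Y) (g : Y -> Z) : {within A, continuous h} ->
  {within B, continuous g} -> (forall x, A x -> B (h x)) ->
  {within A, continuous (g \o h)}.
Proof.
move=> ch cg AB; apply/subspace_continuousP => x Ax.
have hx := iffLR (subspace_continuousP A h) ch x Ax.
have gx := iffLR (subspace_continuousP B g) cg _ (AB _ Ax).
move=> N /gx nN; have := hx _ nN.
apply: (@filterS _ (nbhs x)) => y /= Hy Ay; exact: Hy (AB _ Ay).
Qed.

Lemma within_continuous_eq (X Y : topologicalType) (A : set X) (f g : X -> Y) :
  (forall x, A x -> f x = g x) -> {within A, continuous f} ->
  {within A, continuous g}.
Proof.
by move=> fg; apply: subspace_eq_continuous => x /set_mem Ax; exact: fg.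
Qed.

Lemma open_within_continuous (X Y : topologicalType) (A : set X) (f : X -> Y) x :
  open A -> {within A, continuous f} -> A x -> {for x, continuous f}.
Proof.
move=> oA cf Ax N /(iffLR (subspace_continuousP A f) cf x Ax) H.
have nA : nbhs x A by exact: open_nbhs_nbhs.
apply: (@filterS _ (nbhs x) _ _ _ _ (@filterI _ (nbhs x) _ _ _ H nA)) => y.
by move=> [+ Ay]; apply.
Qed.

Lemma ptws_continuous (X : topologicalType) (I : Type) (Y : uniformType)
    (f : X -> {ptws I -> Y}) :
  (forall i, continuous (fun x => f x i)) -> continuous f.
Proof.
move=> cf x; apply/cvg_sup => i N [V] [[W] oW <-] Wf VN.
have : nbhs x [set y | W (f y i)].
  by apply: (cf i x); apply: open_nbhs_nbhs; split.
by apply: (@filterS _ (nbhs x)) => y Wy; exact: VN.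
Qed.

Lemma ptws_eval_continuous (I : eqType) (Y : uniformType) (i : I) :
  continuous (fun w : {ptws I -> Y} => w i).
Proof. exact: (@proj_continuous I (fun=> Y) i). Qed.

Section Dirs.
Context (R : realType) (E : tvsType R).

(** Derivatives are taken in the last direction of a tuple, so the recursion on the
   order drops the last entry. *)
Definition init_dirs k (w : {ptws 'I_k.+1 -> E}) : {ptws 'I_k -> E} :=
  fun i => w (widen_ord (leqnSn k) i).

End Dirs.

Lemma dirsS (R : realType) (E : lcsType R) k (w : {ptws 'I_k.+1 -> E}) :
  dirs w = rcons (dirs (init_dirs w)) (w ord_max).
Proof. by rewrite /dirs enum_ordSr map_rcons -map_comp. Qed.

Section IterStep.
Context (R : realType) (E : tvsType R) (F : lcsType R).

Lemma iter_dderive_rcons vs v (f : E -> F) :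
  iter_dderive (rcons vs v) f = dderive (iter_dderive vs f) v.
Proof. by rewrite /iter_dderive foldl_rcons. Qed.

Lemma iter_dderivable_rcons (A : set E) vs v (f : E -> F) :
  iter_dderivable A (rcons vs v) f <->
  iter_dderivable A vs f /\ (forall x, A x -> dderivable (iter_dderive vs f) v x).
Proof.
elim: vs f => [|u vs IH] f /=; first by split => -[? ?].
by rewrite IH; split => [[? []]|[[]]].
Qed.

(** The functions a and b come from jets and need not be iterated derivatives outside
   A; since A is open, derivatives at its points do not see the difference. *)
Lemma iter_dderive_step (A : set E) vs v (f a b : E -> F) : open A ->
  iter_dderivable A vs f -> (forall x, A x -> iter_dderive vs f x = a x) ->
  (forall x, A x -> is_dderive a v x (b x)) ->
  iter_dderivable A (rcons vs v) f /\
  (forall x, A x -> iter_dderive (rcons vs v) f x = b x).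
Proof.
move=> oA df fa ab.
have D x : A x -> is_dderive (iter_dderive vs f) v x (b x).
  move=> Ax; apply: is_dderive_near (ab x Ax).
  have nA : nbhs x A by exact: open_nbhs_nbhs.
  by apply: (@filterS _ (nbhs x) _ _ _ _ nA) => y /fa.
split.
  by apply/iter_dderivable_rcons; split => // x Ax; exists (b x); exact: D.
by move=> x Ax; rewrite iter_dderive_rcons; apply: dderiveE; exact: D.
Qed.

End IterStep.

Lemma le_smoothnessW j k r : (j <= k)%N -> le_smoothness k r -> le_smoothness j r.
Proof. by case: r => //= n; exact: leq_trans. Qed.

Lemma le_smoothness0 r : le_smoothness 0 r.
Proof. by case: r. Qed.

Lemma ptws_I0 (R : realType) (E : lcsType R) (w w' : {ptws 'I_0 -> E}) : w = w'.
Proof. by apply/funext => -[]. Qed.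

Lemma dirs0 (R : realType) (E : lcsType R) (w : {ptws 'I_0 -> E}) : dirs w = [::].
Proof. by rewrite /dirs (size0nil (size_enum_ord 0)). Qed.

Lemma setXT_dense (X P : topologicalType) (A B : set X) : B `<=` closure A ->
  B `*` [set: P] `<=` closure (A `*` setT).
Proof.
move=> BA [x p] [/= /BA clx _] S [[S1 S2] /= [S1x S2p] S12].
have [y [Ay Sy]] := clx _ S1x.
by exists (y, p); split => //; apply: S12; split => //=; exact: nbhs_singleton.
Qed.

Lemma setXT_sub (X P : Type) (A B : set X) : A `<=` B ->
  A `*` [set: P] `<=` B `*` setT.
Proof. by move=> AB z [/AB]. Qed.

Section CrJet.
Context (R : realType) (E F : lcsType R) (U : set E) (r : smoothness).
Implicit Types (e : forall k, E * {ptws 'I_k -> E} -> F) (f : E -> F).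

(** The e k are to be the maps d^(k) f.  The equation is required at interior points,
   where derivatives are defined, and continuity on all of U. *)
Definition Cr_jet e f : Prop :=
  [/\ forall k, le_smoothness k r -> {within U `*` setT, continuous (e k)},
      forall x w, U x -> e 0%N (x, w) = f x
    & forall k, le_smoothness k.+1 r -> forall x (w : {ptws 'I_k.+1 -> E}), U° x ->
        is_dderive (fun z => e k (z, init_dirs w)) (w ord_max) x (e k.+1 (x, w))].

Lemma Cr_jet_iter e f : Cr_jet e f ->
  forall k, le_smoothness k r -> forall w : {ptws 'I_k -> E},
  iter_dderivable U° (dirs w) f /\
  (forall x, U° x -> iter_dderive (dirs w) f x = e k (x, w)).
Proof.
move=> [_ e0 eS]; elim=> [|k IH] kr w.
  by rewrite dirs0; split => // x /interior_subset /e0 ->.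
have [d1 d2] := IH (le_smoothnessW (leqnSn k) kr) (init_dirs w).
rewrite dirsS; apply: (iter_dderive_step (@open_interior _ U) d1 d2) => x Ux.
exact: eS.
Qed.

Lemma Cr_jet_cont_ext e f : Cr_jet e f -> forall k, le_smoothness k r ->
  is_diff_ext (@dirs R E k) U° U f (e k).
Proof.
move=> ef k kr; split; first by case: ef => + _ _; exact.
move=> [x w] /set_mem [/= Ux _]; rewrite /iter_diff /=.
by have [_ ->] := Cr_jet_iter ef kr w.
Qed.

Lemma Cr_jet_dk e f : dense_interior U -> Cr_jet e f ->
  forall k, le_smoothness k r -> forall x w, U x -> dk U f (x, w) = e k (x, w).
Proof.
move=> dU ef k kr x w Ux.
have := cont_extE (setXT_sub (@interior_subset _ U)) (@setXT_dense _ _ _ _ dU)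
  (Cr_jet_cont_ext ef kr).
by apply; rewrite inE.
Qed.

Lemma Cr_jet_on e f : dense_interior U -> Cr_jet e f -> Cr_on U r f.
Proof.
move=> dU ef; split.
- move=> k kr; split; first by move=> w; have [] := Cr_jet_iter ef kr w.
  apply: (@within_continuous_eq _ _ _ (e k)).
    move=> [x w] [/= Ux _]; rewrite /iter_diff /=.
    by have [_ ->] := Cr_jet_iter ef kr w.
  apply: continuous_subspaceW (setXT_sub (@interior_subset _ U)) _.
  by case: ef => + _ _; exact.
- by move=> k kr; exists (e k); exact: Cr_jet_cont_ext.
- move=> x w Ux; rewrite (Cr_jet_dk dU ef (le_smoothness0 r))//.
  by case: ef => _ ->.
Qed.

Lemma Cr_on_jet f : Cr_on U r f -> Cr_jet (fun k => @dk R E F U k f) f.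
Proof.
move=> [f1 f2 f3].
have ext k : le_smoothness k r -> is_diff_ext (@dirs R E k) U° U f (dk U f).
  by move=> kr; exact: cont_extP (f2 k kr).
have extE k (kr : le_smoothness k r) x w : U° x ->
    dk U f (x, w) = iter_dderive (@dirs R E k w) f x.
  by move=> Ux; have [_ ->//] := ext k kr; rewrite inE.
split => //; first by move=> k /ext [].
move=> k kr x w Ux; have [/(_ w) df _] := f1 _ kr.
rewrite extE//.
move: df; rewrite dirsS => /iter_dderivable_rcons [_ /(_ x Ux) /dderivableP].
rewrite -iter_dderive_rcons; apply: is_dderive_near.
have nU : nbhs x U° by apply: open_nbhs_nbhs; split => //; exact: open_interior.
apply: (@filterS _ (nbhs x) _ _ _ _ nU) => y Uy.
by rewrite extE// (le_smoothnessW (leqnSn k) kr).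
Qed.

End CrJet.

Section CrsJet.
Context (R : realType) (E1 E2 F : lcsType R) (U : set E1) (V : set E2).
Context (r s : smoothness).
Implicit Types (f : E1 * E2 -> F).
Implicit Types (e : forall i j,
  (E1 * E2) * ({ptws 'I_i -> E1} * {ptws 'I_j -> E2}) -> F).

(** Since the directions in E2 are used first, the equation in these directions is
   only part of the data for i = 0; for general i it is Crs_jet_dV. *)
Definition Crs_jet e f : Prop :=
  [/\ forall i j, le_smoothness i r -> le_smoothness j s ->
        {within (U `*` V) `*` setT, continuous (e i j)},
      forall z wv, (U `*` V) z -> e 0%N 0%N (z, wv) = f z,
      forall j, le_smoothness j.+1 s ->
        forall z (w : {ptws 'I_0 -> E1}) (v : {ptws 'I_j.+1 -> E2}),
        (U° `*` V°) z ->
        is_dderive (fun z => e 0%N j (z, (w, init_dirs v))) (0, v ord_max) z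
          (e 0%N j.+1 (z, (w, v)))
    & forall i j, le_smoothness i.+1 r -> le_smoothness j s ->
        forall z (w : {ptws 'I_i.+1 -> E1}) (v : {ptws 'I_j -> E2}),
        (U° `*` V°) z ->
        is_dderive (fun z => e i j (z, (init_dirs w, v))) (w ord_max, 0) z
          (e i.+1 j (z, (w, v)))].

Lemma dirs2S i j (w : {ptws 'I_i.+1 -> E1}) (v : {ptws 'I_j -> E2}) :
  dirs2 (w, v) = rcons (dirs2 (init_dirs w, v)) (w ord_max, 0).
Proof. by rewrite /dirs2 /= dirsS map_rcons -rcons_cat. Qed.

Lemma dirs2_0S j (w : {ptws 'I_0 -> E1}) (v : {ptws 'I_j.+1 -> E2}) :
  dirs2 (w, v) = rcons (dirs2 (w, init_dirs v)) (0, v ord_max).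
Proof. by rewrite /dirs2 /= [dirs v]dirsS dirs0 !cats0 map_rcons. Qed.

Lemma dirs2_00 (w : {ptws 'I_0 -> E1}) (v : {ptws 'I_0 -> E2}) :
  dirs2 (w, v) = [::].
Proof. by rewrite /dirs2 /= !dirs0. Qed.

Let oUV := @open_interiorX R E1 E2 U V.
Let sUV := @interiorX_subset R E1 E2 U V.

Lemma Crs_jet_iter e f : Crs_jet e f ->
  forall i j, le_smoothness i r -> le_smoothness j s -> forall wv,
  iter_dderivable (U° `*` V°) (@dirs2 R E1 E2 i j wv) f /\
  (forall z, (U° `*` V°) z ->
    iter_dderive (@dirs2 R E1 E2 i j wv) f z = e i j (z, wv)).
Proof.
move=> [_ e0 eV eU]; elim=> [|i IH] j ir js [w v].
  elim: j js v => [|j IH] js v.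
    by rewrite dirs2_00; split => // z /sUV/e0 ->.
  have [d1 d2] := IH (le_smoothnessW (leqnSn j) js) (init_dirs v).
  by rewrite dirs2_0S; apply: (iter_dderive_step oUV d1 d2) => z Uz; exact: eV.
have [d1 d2] := IH j (le_smoothnessW (leqnSn i) ir) js (init_dirs w, v).
by rewrite dirs2S; apply: (iter_dderive_step oUV d1 d2) => z Uz; exact: eU.
Qed.

Lemma Crs_jet_cont_ext e f : Crs_jet e f ->
  forall i j, le_smoothness i r -> le_smoothness j s ->
  is_diff_ext (@dirs2 R E1 E2 i j) (U° `*` V°) (U `*` V) f (e i j).
Proof.
move=> ef i j ir js; split; first by case: ef => + _ _ _; exact.
move=> [z w] /set_mem [/= Uz _]; rewrite /iter_diff /=.
by have [_ ->] := Crs_jet_iter ef ir js w.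
Qed.

Hypotheses (dU : dense_interior U) (dV : dense_interior V).

Lemma Crs_jet_dij e f : Crs_jet e f ->
  forall i j, le_smoothness i r -> le_smoothness j s ->
  forall z wv, (U `*` V) z -> dij U V f (z, wv) = e i j (z, wv).
Proof.
move=> ef i j ir js z wv Uz.
have := cont_extE (setXT_sub sUV) (@setXT_dense _ _ _ _ (dense_interiorX dU dV))
  (Crs_jet_cont_ext ef ir js).
by apply; rewrite inE.
Qed.

Lemma Crs_jet_on e f : Crs_jet e f -> Crs_on U V r s f.
Proof.
move=> ef; split.
- move=> i j ir js; split; first by move=> w; have [] := Crs_jet_iter ef ir js w.
  apply: (@within_continuous_eq _ _ _ (e i j)).
    move=> [x w] [/= Ux _]; rewrite /iter_diff /=.
    by have [_ ->] := Crs_jet_iter ef ir js w.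
  apply: continuous_subspaceW (setXT_sub sUV) _.
  by case: ef => + _ _ _; exact.
- by move=> i j ir js; exists (e i j); exact: Crs_jet_cont_ext.
- move=> x y w Ux Vy.
  rewrite (Crs_jet_dij ef (le_smoothness0 r) (le_smoothness0 s))//.
  by case: ef => _ ->.
Qed.

Lemma Crs_on_jet f : Crs_on U V r s f ->
  Crs_jet (fun i j => @dij R E1 E2 F U V i j f) f.
Proof.
move=> [f1 f2 f3].
have ext i j : le_smoothness i r -> le_smoothness j s ->
    is_diff_ext (@dirs2 R E1 E2 i j) (U° `*` V°) (U `*` V) f (dij U V f).
  by move=> ir js; exact: cont_extP (f2 i j ir js).
have extE i j (ir : le_smoothness i r) (js : le_smoothness j s) z w :
    (U° `*` V°) z -> dij U V f (z, w) = iter_dderive (@dirs2 R E1 E2 i j w) f z.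
  by move=> Uz; have [_ ->//] := ext i j ir js; rewrite inE.
split.
- by move=> i j ir js; have [] := ext i j ir js.
- by move=> [x y] wv [/= Ux Vy]; exact: f3.
- move=> j js z w v Uz; have [/(_ (w, v)) df _] := f1 _ _ (le_smoothness0 r) js.
  rewrite extE ?le_smoothness0//.
  move: df; rewrite dirs2_0S => /iter_dderivable_rcons [_ /(_ z Uz) /dderivableP].
  rewrite -iter_dderive_rcons; apply: is_dderive_near.
  have nU : nbhs z (U° `*` V°) by apply: open_nbhs_nbhs; split.
  apply: (@filterS _ (nbhs z) _ _ _ _ nU) => y Uy.
  by rewrite extE ?le_smoothness0// (le_smoothnessW (leqnSn j) js).
- move=> i j ir js z w v Uz; have [/(_ (w, v)) df _] := f1 _ _ ir js.
  rewrite extE//.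
  move: df; rewrite dirs2S => /iter_dderivable_rcons [_ /(_ z Uz) /dderivableP].
  rewrite -iter_dderive_rcons; apply: is_dderive_near.
  have nU : nbhs z (U° `*` V°) by apply: open_nbhs_nbhs; split.
  apply: (@filterS _ (nbhs z) _ _ _ _ nU) => y Uy.
  by rewrite extE// (le_smoothnessW (leqnSn i) ir).
Qed.

End CrsJet.

(** * Exchanging the two orders of differentiation *)

Section PartialDerivatives.
Context (R : realType) (E1 E2 F : lcsType R).

Lemma is_dderive_fst (f : E1 * E2 -> F) w x y l :
  is_dderive f (w, 0) (x, y) l <-> is_dderive (fun x' => f (x', y)) w x l.
Proof.
rewrite /is_dderive.
suff -> : (fun t : R => t^-1 *: (f ((x, y) + t *: (w, 0 : E2)) - f (x, y))) =
  (fun t : R => t^-1 *: (f (x + t *: w, y) - f (x, y))) by [].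
apply/funext => t; congr (_ *: (f _ - _)).
by congr (_, _); rewrite /= scaler0 addr0.
Qed.

Lemma is_dderive_snd (f : E1 * E2 -> F) v x y l :
  is_dderive f (0, v) (x, y) l <-> is_dderive (fun y' => f (x, y')) v y l.
Proof.
rewrite /is_dderive.
suff -> : (fun t : R => t^-1 *: (f ((x, y) + t *: (0 : E1, v)) - f (x, y))) =
  (fun t : R => t^-1 *: (f (x, y + t *: v) - f (x, y))) by [].
apply/funext => t; congr (_ *: (f _ - _)).
by congr (_, _); rewrite /= scaler0 addr0.
Qed.

End PartialDerivatives.

Section CrsJetTheory.
Context (R : realType) (E1 E2 F : lcsType R) (U : set E1) (V : set E2).
Context (r s : smoothness).
Hypotheses (dU : dense_interior U) (dV : dense_interior V).
Variables (f : E1 * E2 -> F) (e : forall i j,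
  (E1 * E2) * ({ptws 'I_i -> E1} * {ptws 'I_j -> E2}) -> F).
Arguments e : clear implicits.
Hypothesis ef : Crs_jet U V r s e f.

Let oUV := @open_interiorX R E1 E2 U V.
Let sUV := @interiorX_subset R E1 E2 U V.

Lemma Crs_jet_slice_continuous i j wv : le_smoothness i r -> le_smoothness j s ->
  {within U `*` V, continuous (fun z => e i j (z, wv))}.
Proof.
move=> ir js; case: ef => /(_ i j ir js) ce _ _ _.
apply: (within_continuous_comp _ ce); last by move=> z Uz; split.
apply: continuous_subspaceT; apply: continuous_pair.
  by move=> x; exact: cvg_id.
by move=> x; exact: cvg_cst.
Qed.

(** By induction on i, each step moving one derivative in a direction of E2 past one
   in a direction of E1. *)
Let Crs_jet_dV_interior i j : le_smoothness i r -> le_smoothness j.+1 s ->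
  forall z (w : {ptws 'I_i -> E1}) (v : {ptws 'I_j.+1 -> E2}), (U° `*` V°) z ->
  is_dderive (fun z => e i j (z, (w, init_dirs v))) (0, v ord_max) z
    (e i j.+1 (z, (w, v))).
Proof.
have [ce _ eV eU] := ef.
elim: i => [|i IH] ir js z w v Uz; first exact: eV.
apply: (@schwarz R _ F (U° `*` V°)
  (fun z => e i j (z, (init_dirs w, init_dirs v)))
  (fun z => e i j.+1 (z, (init_dirs w, v)))
  (fun z => e i.+1 j (z, (w, init_dirs v)))
  (fun z => e i.+1 j.+1 (z, (w, v))) (0, v ord_max) (w ord_max, 0)) => //.
- by move=> z' Uz'; apply: IH => //; exact: le_smoothnessW ir.
- by move=> z' Uz'; apply: eU => //; exact: le_smoothnessW js.
- by move=> z' Uz'; exact: eU.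
- apply: (open_within_continuous oUV) Uz.
  by apply: continuous_subspaceW sUV _; exact: Crs_jet_slice_continuous.
Qed.

(** Holds for every x in U, boundary points included: moving y alone stays inside
   U x V as soon as y is interior. *)
Lemma Crs_jet_dV i j : le_smoothness i r -> le_smoothness j.+1 s ->
  forall x y (w : {ptws 'I_i -> E1}) (v : {ptws 'I_j.+1 -> E2}), U x -> V° y ->
  is_dderive (fun y => e i j ((x, y), (w, init_dirs v))) (v ord_max) y
    (e i j.+1 ((x, y), (w, v))).
Proof.
move=> ir js x y w v Ux Vy.
apply/(@is_dderive_snd _ _ _ _ (fun z => e i j (z, (w, init_dirs v)))).
have js' := le_smoothnessW (leqnSn j) js.
apply: (@is_dderive_closure R _ F (U° `*` V°) (U `*` V)
  (fun z => e i j (z, (w, init_dirs v)))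
  (fun z => e i j.+1 (z, (w, v)))) => //.
- by apply: dense_interiorX => //; split => //; exact: interior_subset.
- by split => //; exact: interior_subset.
- have := line_near0 (v ord_max) (@open_interior _ V) Vy.
  apply: (@filterS _ (nbhs (0 : R))) => t /interior_subset Vt.
  by split => //=; rewrite scaler0 addr0.
- have [[S T] [/= yS T0] ST] := line_near1 (v ord_max) (@open_interior _ V) Vy.
  exists ([set z | U° z.1 /\ S z.2], T) => //=.
    split => //=; exists (setT, S); first by split => //=; exact: filterT.
    by move=> [x' y'] [_ /= Sy] [/= Ux' Vy'].
  move=> [[x' y'] t] [/= [Ux' Sy'] Tt]; split => /=; first by rewrite scaler0 addr0.
  exact: (ST (y', t)).
- exact: Crs_jet_slice_continuous.
- exact: Crs_jet_slice_continuous.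
- by move=> q Uq; exact: Crs_jet_dV_interior.
Qed.

(** Holds for every y in V, which is needed to see the w-derivatives as limits in a
   space of functions on all of V. *)
Lemma Crs_jet_dU i j : le_smoothness i.+1 r -> le_smoothness j s ->
  forall x y (w : {ptws 'I_i.+1 -> E1}) (v : {ptws 'I_j -> E2}), U° x -> V y ->
  is_dderive (fun x => e i j ((x, y), (init_dirs w, v))) (w ord_max) x
    (e i.+1 j ((x, y), (w, v))).
Proof.
move=> ir js x y w v Ux Vy.
apply/(@is_dderive_fst _ _ _ _ (fun z => e i j (z, (init_dirs w, v)))).
have ir' := le_smoothnessW (leqnSn i) ir.
apply: (@is_dderive_closure R _ F (U° `*` V°) (U `*` V)
  (fun z => e i j (z, (init_dirs w, v)))
  (fun z => e i.+1 j (z, (w, v)))) => //.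
- by apply: dense_interiorX => //; split => //; exact: interior_subset.
- by split => //; exact: interior_subset.
- have := line_near0 (w ord_max) (@open_interior _ U) Ux.
  apply: (@filterS _ (nbhs (0 : R))) => t /interior_subset Ut.
  by split => //=; rewrite scaler0 addr0.
- have [[S T] [/= xS T0] ST] := line_near1 (w ord_max) (@open_interior _ U) Ux.
  exists ([set z | S z.1 /\ V° z.2], T) => //=.
    split => //=; exists (S, setT); first by split => //=; exact: filterT.
    by move=> [x' y'] [/= Sx _] [/= Ux' Vy'].
  move=> [[x' y'] t] [/= [Sx' Vy'] Tt]; split => /=; last by rewrite scaler0 addr0.
  exact: (ST (x', t)).
- exact: Crs_jet_slice_continuous.
- exact: Crs_jet_slice_continuous.
- by move=> q Uq; case: ef => _ _ _; exact.
Qed.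

(** Freezing x and w gives a jet in y: the derivatives of f in directions of E1 are
   C^s functions of y.  The entry of order 0 takes the empty tuple of directions,
   for which fun=> 0 is a name. *)
Lemma Crs_jet_snd i x (w : {ptws 'I_i -> E1}) : le_smoothness i r -> U x ->
  Cr_jet V s (fun j z => e i j ((x, z.1), (w, z.2)))
    (fun y => e i 0%N ((x, y), (w, fun=> 0))).
Proof.
move=> ir Ux; have [ce _ _ _] := ef; split.
- move=> j js; apply: (within_continuous_comp _ (ce i j ir js)).
    apply: continuous_subspaceT; apply: continuous_pair; apply: continuous_pair.
    + by move=> z; exact: cvg_cst.
    + exact: continuous_fst.
    + by move=> z; exact: cvg_cst.
    + exact: continuous_snd.
  by move=> z [Vz _]; split.
- by move=> y v Vy /=; rewrite (ptws_I0 v (fun=> 0)).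
- by move=> j js y v Vy; exact: Crs_jet_dV.
Qed.

Lemma Crs_jet_fst j y (v : {ptws 'I_j -> E2}) : le_smoothness j s -> V y ->
  Cr_jet U r (fun i z => e i j ((z.1, y), (z.2, v)))
    (fun x => e 0%N j ((x, y), (fun=> 0, v))).
Proof.
move=> js Vy; have [ce _ _ _] := ef; split.
- move=> i ir; apply: (within_continuous_comp _ (ce i j ir js)).
    apply: continuous_subspaceT; apply: continuous_pair; apply: continuous_pair.
    + exact: continuous_fst.
    + by move=> z; exact: cvg_cst.
    + exact: continuous_snd.
    + by move=> z; exact: cvg_cst.
  by move=> z [Vz _]; split.
- by move=> x w Ux /=; rewrite (ptws_I0 w (fun=> 0)).
- by move=> i ir x w Ux; exact: Crs_jet_dU.
Qed.

End CrsJetTheory.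

(** * Curried maps into spaces of differentiable functions *)

Lemma pair_cvg (Q : Type) (G : set_system Q) {FG : Filter G}
    (X Y : topologicalType) (f : Q -> X) (g : Q -> Y) (a : X) (b : Y) :
  f @ G --> a -> g @ G --> b -> (f q, g q) @[q --> G] --> (a, b).
Proof. exact: cvg_pair. Qed.

Lemma within_cvg (Q : Type) (G : set_system Q) {FG : Filter G}
    (X Y : topologicalType) (A : set X) (f : X -> Y) (h : Q -> X) (z : X) :
  {within A, continuous f} -> A z -> h @ G --> z ->
  (\forall q \near G, A (h q)) -> f (h q) @[q --> G] --> f z.
Proof.
move=> cf Az hz Ah N nN.
have nA := hz _ (iffLR (subspace_continuousP A f) cf z Az _ nN).
by apply: (@filterS _ G _ _ _ _ (@filterI _ G _ _ _ nA Ah)) => q [+ Aq]; apply.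
Qed.

Section InitialLcsConvergence.
Context (R : realType) (F : lcsType R) (T : lmodType R) (J : Type).
Context (Y : J -> topologicalType) (D : forall i, T -> Y i -> F).
Hypotheses (linD : ops_linear D) (contD : ops_continuous D)
  (injD : ops_injective D).
Local Notation W := (initial_lcs linD contD injD).

Lemma ops0 i x : D (i := i) 0 x = 0.
Proof.
have := @linD i 1 0 0 x; rewrite scaler0 addr0 scale1r => /eqP.
by rewrite -subr_eq subrr => /eqP.
Qed.

Lemma opsZB i a f g x : D (i := i) (a *: (f - g)) x = a *: (D f x - D g x).
Proof.
rewrite -[in LHS](addr0 (a *: _)) linD ops0 addr0; congr (_ *: _).
by rewrite addrC -scaleN1r linD scaleN1r addrC.
Qed.

(** Compactness of K turns convergence that is locally uniform at each of its points
   into the uniform convergence which the compact-open topology asks for. *)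
Lemma initial_lcs_cvg (Q : Type) (G : set_system Q) {FG : Filter G}
    (a : Q -> W) (h : W) :
  (forall i (K : set (Y i)), compact K -> forall x, K x ->
    D (i := i) (a z.1) z.2 @[z --> filter_prod G (within K (nbhs x))] --> D h x) ->
  a @ G --> h.
Proof.
move=> H; apply/initial_lcs_cvgP => i K O cK oO hKO.
suff : \forall q \near G, K `<=` [set x | O (D (a q) x)].
  by apply: (@filterS _ G) => q /= qK _ [x Kx <-]; exact: qK.
apply: (@compact_nearW _ _ G K (fun q x => O (D (a q) x)) FG cK) => x Kx.
have [|[A B] [/= GA nB] AB] := H i K cK x Kx O.
  by apply: open_nbhs_nbhs; split => //; apply: hKO; exists x.
exists ([set x' | K x' -> B x'], A) => //= -[x' q] [/= Bx' Aq] Kx'.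
by apply: (AB (q, x')); split => //; exact: Bx'.
Qed.

(** Confining b to a compact set K makes evaluation jointly continuous; a general
   filter makes the rule applicable to composites. *)
Lemma initial_lcs_op_cvg (Q : Type) (G : set_system Q) {FG : Filter G} i
    (K : set (Y i)) (a : Q -> W) (b : Q -> Y i) (h : W) (x : Y i) : compact K ->
  a @ G --> h -> b @ G --> x -> (\forall q \near G, K (b q)) ->
  D (a q) (b q) @[q --> G] --> D h x.
Proof.
move=> cK ah bx Kb A nA.
have [[P H] [/= nP nH] PH] := initial_lcs_eval_near cK nA.
have Gall := @filterI _ G FG _ _ (@filterI _ G FG _ _ (ah _ nH) (bx _ nP)) Kb.
suff : G [set q | A (D (a q) (b q))] by [].
apply: (@filterS _ G _ _ _ _ Gall) => q [[Hq Pq] Kq].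
exact: (PH (b q, a q)).
Qed.

End InitialLcsConvergence.

Section CrSpaceTheory.
Context (R : realType) (E F : lcsType R) (s : smoothness) (M : manifold E).

Definition cr_index (psi : chart E M) (apsi : maximal_atlas psi) j
    (js : le_smoothness j s) : Cr_index s M :=
  (exist _ psi apsi, exist (le_smoothness^~ s) j js).

Lemma is_Cr_insub (h : M -> F) : is_Cr s h -> val (insubd (0 : Cr s M F) h) = h.
Proof. by move=> hs; rewrite insubdK//; exact/asboolP. Qed.

End CrSpaceTheory.

Section Curry.
Context (R : realType) (E1 E2 F : lcsType R) (r s : smoothness).
Context (M1 : manifold E1) (M2 : manifold E2).
Variable f : M1 * M2 -> F.
Hypothesis fC : is_Crs r s f.

Section Chart.
Variables (phi : chart E1 M1) (aphi : maximal_atlas phi).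
Local Notation U := (chart_cod phi).
Let dU : dense_interior U := @chart_cod_dense_interior _ _ _ phi.
Let dV (psi : chart E2 M2) : dense_interior (chart_cod psi) :=
  @chart_cod_dense_interior _ _ _ psi.

Definition chart_dij (psi : chart E2 M2) i j :=
  @dij R E1 E2 F U (chart_cod psi) i j (f \o chart_inv2 phi psi).
Arguments chart_dij : clear implicits.

Let jet psi (apsi : maximal_atlas psi) :
  Crs_jet U (chart_cod psi) r s (chart_dij psi) (f \o chart_inv2 phi psi).
Proof. exact/Crs_on_jet/fC. Qed.

(** The candidate for the i-th derivative of f^v at p, as a function on M2.  It is
   defined without reference to a chart of M2, so that the local descriptions
   curry_dkE fit together. *)
Definition curry_dk i (p : E1 * {ptws 'I_i -> E1}) (m : M2) : F :=
  @dk R E1 F U i (fun x => f (chart_inv phi x, m)) p.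

Let curry_dkE psi (apsi : maximal_atlas psi) i (ir : le_smoothness i r) x w y :
  U x -> chart_cod psi y ->
  @curry_dk i (x, w) (chart_inv psi y) = chart_dij psi i 0%N ((x, y), (w, fun=> 0)).
Proof.
move=> Ux Vy; rewrite /curry_dk.
have [ce _ eS] :=
  Crs_jet_fst dU (dV (psi := psi)) (jet apsi) (fun=> 0) (le_smoothness0 s) Vy.
have Je : Cr_jet U r (fun i (z : E1 * {ptws 'I_i -> E1}) =>
    chart_dij psi i 0%N ((z.1, y), (z.2, fun=> 0)))
    (fun x => f (chart_inv phi x, chart_inv psi y)).
  split => // x' w' Ux' /=; have [_ e0 _ _] := jet apsi.
  by rewrite (ptws_I0 w' (fun=> 0)) e0.
by rewrite (Cr_jet_dk dU Je).
Qed.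

Let curry_dk_jet psi (apsi : maximal_atlas psi) i (ir : le_smoothness i r) x w :
  U x ->
  Cr_jet (chart_cod psi) s (fun j z => chart_dij psi i j ((x, z.1), (w, z.2)))
    (@curry_dk i (x, w) \o chart_inv psi).
Proof.
move=> Ux; have [ce e0 eS] := Crs_jet_snd dU (dV (psi := psi)) (jet apsi) w ir Ux.
by split => // y v Vy; rewrite e0//= curry_dkE.
Qed.

Lemma curry_dk_is_Cr i (ir : le_smoothness i r) p : U p.1 -> is_Cr s (@curry_dk i p).
Proof.
case: p => x w Ux psi apsi.
exact: Cr_jet_on (dV (psi := psi)) (curry_dk_jet apsi ir w Ux).
Qed.

(** curry_dk p as an element of C^s(M2, F), with the default value 0 for the points p
   outside U, where curry_dk p is arbitrary. *)
Definition curry_dkC i (p : E1 * {ptws 'I_i -> E1}) : Cr s M2 F :=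
  insubd 0 (curry_dk p).

Lemma dk_curry_dkC psi (apsi : maximal_atlas psi) i j x w y v :
  le_smoothness i r -> le_smoothness j s -> U x -> chart_cod psi y ->
  @dk R E2 F (chart_cod psi) j (@curry_dkC i (x, w) \o chart_inv psi) (y, v) =
  chart_dij psi i j ((x, y), (w, v)).
Proof.
move=> ir js Ux Vy.
have -> : (@curry_dkC i (x, w) : M2 -> F) = curry_dk (x, w).
  by apply: is_Cr_insub; exact: curry_dk_is_Cr.
by rewrite (Cr_jet_dk (dV (psi := psi)) (curry_dk_jet apsi ir w Ux)).
Qed.

Lemma curry_dk0 (p : E1 * {ptws 'I_0 -> E1}) : U p.1 ->
  curry_dk p = (fun m => f (chart_inv phi p.1, m)).
Proof.
case: p => x w Ux; apply/funext => m.
have [psi apsi psim] := maximal_atlas_cover m.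
have Vm := chart_map_cod psim.
rewrite -[in LHS](chart_mapK psim) (curry_dkE apsi (le_smoothness0 r))//.
have [_ e0 _ _] := jet apsi.
rewrite (ptws_I0 w (fun=> 0)) e0//=.
by rewrite /chart_inv2 /= chart_mapK.
Qed.

Variable g : M1 -> Cr s M2 F.
Hypothesis gf : forall x y, g x y = f (x, y).

Let dij_cvg psi (apsi : maximal_atlas psi) i j (Q : Type) (G : set_system Q)
    {FG : Filter G} (X : Q -> E1) (Y : Q -> E2) (W : Q -> {ptws 'I_i -> E1})
    (Z : Q -> {ptws 'I_j -> E2}) (x : E1) (y : E2) (w : {ptws 'I_i -> E1})
    (v : {ptws 'I_j -> E2}) :
  le_smoothness i r -> le_smoothness j s -> U x -> chart_cod psi y ->
  X @ G --> x -> Y @ G --> y -> W @ G --> w -> Z @ G --> v ->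
  (\forall q \near G, U (X q)) -> (forall q, chart_cod psi (Y q)) ->
  chart_dij psi i j ((X q, Y q), (W q, Z q)) @[q --> G] -->
  chart_dij psi i j ((x, y), (w, v)).
Proof.
move=> ir js Ux Vy Xx Yy Ww Zv UX VY; have [ce _ _ _] := jet apsi.
apply: (within_cvg (ce i j ir js)) => //.
  by apply: pair_cvg; exact: pair_cvg.
by apply: (@filterS _ G _ _ _ _ UX) => q Uq; split => //; split => //=.
Qed.

(** Continuity into C^s(M2, F) and the equation there both come from the continuity
   of chart_dij, by compactness; for the equation, the parameter q of
   mean_value_cvg is the point of the compact set at which derivatives along M2 are
   evaluated. *)
Lemma curry_jet : Cr_jet U r curry_dkC (g \o chart_inv phi).
Proof.
split.
- move=> i ir; apply/subspace_continuousP => -[x w] [/= Ux _].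
  apply: initial_lcs_cvg => -[[psi apsi] [j js]] K cK [y v] Kyv.
  rewrite /Cr_op /= dk_curry_dkC//; last exact: set_valP.
  set G := filter_prod _ _.
  have UG : G [set z | U z.1.1].
    exists ([set p | U p.1], setT); last by move=> z [].
    split => /=; last exact: filterT.
    apply: (@filterS _ (nbhs (x, w)) _ setT) => [|]; last exact: filterT.
    by move=> p _ [].
  have c1 : z.1 @[z --> G] --> (x, w).
    by apply: cvg_trans (@cvg_fst _ _ _ _ _) _; exact: cvg_within.
  have c2 : z.2 @[z --> G] --> (y, v).
    by apply: cvg_trans (@cvg_snd _ _ _ _ _) _; exact: cvg_within.
  have : chart_dij psi i j ((z.1.1, set_val z.2.1), (z.1.2, z.2.2)) @[z --> G]
      --> chart_dij psi i j ((x, set_val y), (w, v)).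
    apply: (dij_cvg apsi) => //.
    + exact: set_valP.
    + exact: cvg_comp c1 (@continuous_fst _ _ (x, w)).
    + apply: cvg_comp (cvg_comp _ _ c2 (@continuous_fst _ _ (y, v))) _.
      exact: set_val_continuous.
    + exact: cvg_comp c1 (@continuous_snd _ _ (x, w)).
    + exact: cvg_comp c2 (@continuous_snd _ _ (y, v)).
    + by move=> q; exact: set_valP.
  apply: cvg_trans; apply: near_eq_cvg.
  apply: (@filterS _ G _ _ _ _ UG) => -[[x' w'] [y' v']] /= Ux'.
  by rewrite dk_curry_dkC//; exact: set_valP.
- move=> x w Ux; apply/val_inj; rewrite /= -[LHS]/(val (curry_dkC (x, w))).
  rewrite is_Cr_insub; last exact: (@curry_dk_is_Cr 0%N (le_smoothness0 r) (x, w) Ux).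
  rewrite curry_dk0//; apply/funext => m.
  by rewrite -[RHS]/(g (chart_inv phi x) m) gf.
- move=> i ir x w Ux.
  have ir' := le_smoothnessW (leqnSn i) ir.
  have Ux' := interior_subset Ux.
  apply: initial_lcs_cvg => -[[psi apsi] [j js]] K cK [y v] Kyv.
  rewrite [X in _ --> X]/Cr_op /= dk_curry_dkC//; last exact: set_valP.
  set q0 := (y, v).
  pose h (q : Cr_op_dom (cr_index (s := s) apsi js)) (t : R^o) :=
    chart_dij psi i j ((x + t *: w ord_max, set_val q.1), (init_dirs w, q.2)).
  pose h' (q : Cr_op_dom (cr_index (s := s) apsi js)) (t : R^o) :=
    chart_dij psi i.+1 j ((x + t *: w ord_max, set_val q.1), (w, q.2)).
  have Ut := line_near0 (w ord_max) (@open_interior _ U) Ux.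
  have H : z.2^-1 *: (h z.1 z.2 - h z.1 0)
      @[z --> filter_prod (within K (nbhs q0)) (0 : R)^'] -->
      chart_dij psi i.+1 j ((x, set_val y), (w, v)).
    apply: (@mean_value_cvg R F _ (within K (nbhs q0)) _ h h').
      exists (setT, [set t | U° (x + t *: w ord_max)]).
        by split => //=; exact: filterT.
      move=> [q t] [/= _ Uxt].
      apply/(@is_dderive_line R F E1 (fun x' =>
        chart_dij psi i j ((x', set_val q.1), (init_dirs w, q.2)))).
      apply: (Crs_jet_dU dU (dV (psi := psi)) (jet apsi)) => //.
      exact: set_valP.
    set G := filter_prod _ _.
    have c1 : z.1 @[z --> G] --> q0.
      by apply: cvg_trans (@cvg_fst _ _ _ _ _) _; exact: cvg_within.
    have c2 : z.2 @[z --> G] --> (0 : R) by exact: cvg_snd.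
    apply: (dij_cvg apsi) => //.
    + exact: set_valP.
    + rewrite -[X in _ --> X](addr0 x) -[X in _ + X](scale0r (w ord_max)).
      by apply: line_cvg => //; exact: cvg_cst.
    + apply: cvg_comp (cvg_comp _ _ c1 (@continuous_fst _ _ (y, v))) _.
      exact: set_val_continuous.
    + exact: cvg_cst.
    + exact: cvg_comp c1 (@continuous_snd _ _ (y, v)).
    + exists (setT, [set t | U° (x + t *: w ord_max)]).
        by split => //=; exact: filterT.
      by move=> [q t] [/= _ /interior_subset].
    + by move=> q; exact: set_valP.
  set G := filter_prod _ _.
  have HG : z.1^-1 *: (h z.2 z.1 - h z.2 0) @[z --> G] -->
      chart_dij psi i.+1 j ((x, set_val y), (w, v)).
    move=> N /H [[A B] [/= nA nB] AB]; exists (B, A) => //.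
    by move=> [t q] [/= Bt Aq]; exact: (AB (q, t)).
  have UG : G [set z | U (x + z.1 *: w ord_max)].
    exists ([set t | U° (x + t *: w ord_max)], setT).
      by split => /=; [exact: near_dnbhs|exact: filterT].
    by move=> [t q] [/= /interior_subset].
  apply: cvg_trans HG; apply: near_eq_cvg.
  apply: (@filterS _ G _ _ _ _ UG) => -[t [y' v']] /= Uxt.
  rewrite (opsZB (@Cr_op_linear R E2 s M2 F)) /Cr_op /=.
  rewrite !dk_curry_dkC//; try exact: set_valP.
  by rewrite /h /= scale0r addr0.
Qed.

Lemma curry_Cr_on : Cr_on U r (g \o chart_inv phi).
Proof. exact: Cr_jet_on dU curry_jet. Qed.

Lemma dk_curry i p : le_smoothness i r -> U p.1 ->
  @dk R E1 (Cr s M2 F) U i (g \o chart_inv phi) p = curry_dkC p.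
Proof. by case: p => x w ir Ux; exact: (Cr_jet_dk dU curry_jet). Qed.

End Chart.

Lemma is_Crs_snd x : is_Cr s (fun y => f (x, y)).
Proof.
have [phi aphi phix] := maximal_atlas_cover x.
have Ux := chart_map_cod phix.
have := curry_dk_is_Cr aphi (p := (phi x, fun=> 0)) (le_smoothness0 r) Ux.
by rewrite curry_dk0//= chart_mapK.
Qed.

End Curry.

(** * Polarization *)

Lemma adjacent_swap_perm (T : eqType) (S : Type) (B : seq T -> S) k :
  (forall p a b q, size (p ++ [:: a, b & q]) = k ->
    B (p ++ [:: a, b & q]) = B (p ++ [:: b, a & q])) ->
  forall vs ws, size vs = k -> perm_eq vs ws -> B vs = B ws.
Proof.
move=> sw.
have move1 a s p q : size (p ++ a :: s ++ q) = k ->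
    B (p ++ a :: s ++ q) = B (p ++ s ++ a :: q).
  elim: s p => [//|b s IH] p sk; rewrite [in LHS]cat_cons sw//.
  rewrite -cat_rcons IH ?cat_rcons//.
  by rewrite -sk !size_cat /= !size_cat !addnS.
have move2 s1 s2 p q : size (p ++ s1 ++ s2 ++ q) = k ->
    B (p ++ s1 ++ s2 ++ q) = B (p ++ s2 ++ s1 ++ q).
  elim: s1 p => [//|a s1 IH] p sk.
  rewrite cat_cons -cat_rcons IH ?cat_rcons ?move1//.
  rewrite -sk !size_cat /= !size_cat !addnS; congr _.+1.
  by rewrite !addnA; congr (_ + _)%N; rewrite -!addnA [(size s2 + _)%N]addnC.
move=> vs ws vk pvw; suff : size ws = k /\ B vs = B ws by case.
move: pvw (conj vk (erefl (B vs))).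
apply: (@catCA_perm_ind _ (fun ws => size ws = k /\ B vs = B ws)).
move=> s1 s2 s3 [sk ->]; split; first by rewrite -sk !size_cat addnCA.
exact: (move2 _ _ [::]).
Qed.

Section Polarization.
Context (R : numFieldType) (E F : lmodType R) (I : Type).

(** The terms of an iterated difference: each i in s is either taken, or dropped at
   the price of a sign. *)
Fixpoint signed_subseqs (s : seq I) : seq (R * seq I) :=
  if s is i :: s' then
    [seq (x.1, i :: x.2) | x <- signed_subseqs s'] ++
    [seq (- x.1, x.2) | x <- signed_subseqs s']
  else [:: (1, [::])].

Variables (B : seq E -> F) (k : nat).
Hypothesis Bperm : forall vs ws, size vs = k -> perm_eq vs ws -> B vs = B ws.
Hypothesis Badd : forall vs a b, (size vs).+1 = k ->
  B (rcons vs (a + b)) = B (rcons vs a) + B (rcons vs b).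

Let B_cons p a b q : (size p + (size q).+1)%N = k ->
  B (p ++ (a + b) :: q) = B (p ++ a :: q) + B (p ++ b :: q).
Proof.
move=> pqk.
have mv c : B (p ++ c :: q) = B (rcons (p ++ q) c).
  apply: Bperm; first by rewrite size_cat.
  by rewrite perm_sym perm_rcons perm_sym -cat1s perm_catCA.
by rewrite !mv Badd// size_cat -addnS.
Qed.

Lemma multilinear_binomial p m a b : (size p + m)%N = k ->
  B (p ++ nseq m (a + b)) =
  \sum_(l < m.+1) B (p ++ nseq (m - l)%N a ++ nseq l b) *+ 'C(m, l).
Proof.
elim: m p => [|m IH] p pk; first by rewrite big_ord_recr big_ord0 /= add0r.
rewrite -[nseq m.+1 _]/(a + b :: nseq m (a + b)) B_cons ?size_nseq//.
have pk' c : (size (rcons p c) + m)%N = k by rewrite size_rcons addSnnS.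
rewrite -!cat_rcons !IH//.
under eq_bigr => l _.
  rewrite cat_rcons -[a :: _]/(nseq (m - l).+1 a ++ _).
  rewrite -subSn; last by rewrite -ltnS.
  over.
have mv (l : 'I_m.+1) : B (rcons p b ++ nseq (m - l)%N a ++ nseq l b) =
    B (p ++ nseq (m.+1 - l.+1)%N a ++ nseq l.+1 b).
  apply: Bperm.
    by rewrite !size_cat !size_nseq size_rcons -pk subnK ?addSnnS// -ltnS.
  rewrite cat_rcons perm_cat2l subSS -[nseq l.+1 b]/([:: b] ++ nseq l b) -cat1s.
  by rewrite perm_catCA.
under [X in _ + X]eq_bigr => l _ do rewrite mv.
rewrite big_ord_recl [RHS]big_ord_recl /= !bin0 -addrA; congr (_ + _).
rewrite [in RHS]big_ord_recr /= [X in _ + X]big_ord_recr /= addrA; congr (_ + _).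
  rewrite -big_split /=; apply: eq_bigr => l _.
  by rewrite /bump /= add1n binS mulrnDr addrC.
by rewrite /bump /= add1n !binn.
Qed.

(** The iterated difference in the steps w i of the polynomial
   u |-> B (p, u, .., u) of degree m.  One difference step replaces it by polynomials
   of lower degree, with leading term m B (p, w i, u, .., u); so as many steps as the
   degree leave the coefficient m!, and more steps leave nothing. *)
Lemma polarization_gen (w : I -> E) s p m u :
  (size p + m)%N = k -> (m <= size s)%N ->
  \sum_(x <- signed_subseqs s) x.1 *: B (p ++ nseq m (u + \sum_(i <- x.2) w i)) =
  if m == size s then B (p ++ [seq w i | i <- s]) *+ m`! else 0.
Proof.
elim: s p m u => [|i s IH] p m u pk.
  by rewrite leqn0 => /eqP ->; rewrite /= big_seq1 /= scale1r.
move=> ms; rewrite /= big_cat /= !big_map /=.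
under eq_bigr => x _.
  rewrite big_cons addrCA multilinear_binomial//.
  rewrite big_ord_recr /= subnn /= binn mulr1n [X in _ *: X]addrC scalerDr; over.
rewrite big_split /=; under [X in _ + X]eq_bigr => x _ do rewrite scaleNr.
under [X in _ + X + _]eq_bigr => x _ do rewrite scaler_sumr.
rewrite sumrN addrAC subrr add0r exchange_big /=.
have step (l : 'I_m) : \sum_(x <- signed_subseqs s) x.1 *:
      (B (p ++ nseq (m - l)%N (w i) ++ nseq l (u + \sum_(j <- x.2) w j))
        *+ 'C(m, l)) =
    (if l == size s :> nat
      then B ((p ++ nseq (m - l)%N (w i)) ++ [seq w j | j <- s]) *+ l`!
      else 0) *+ 'C(m, l).
  rewrite -(IH _ _ u); last by rewrite -ltnS (leq_trans (ltn_ord l)).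
    rewrite -sumrMnl; apply: eq_bigr => x _.
    by rewrite scalerMnr catA.
  by rewrite size_cat size_nseq -addnA subnK// ltnW.
under eq_bigr => l _ do rewrite step.
case: m pk ms step => [|m] pk ms _; first by rewrite big_ord0.
rewrite eqSS big_ord_recr /= big1 ?add0r; last first.
  by move=> l _; rewrite ltn_eqF ?mul0rn// (leq_trans (ltn_ord l)).
have [mE|] := eqVneq m (size s); last by rewrite mul0rn.
by rewrite subSnn -catA /= binSn -mulrnA factS mulnC.
Qed.

Lemma polarization (w : I -> E) s : size s = k ->
  B [seq w i | i <- s] *+ k`! =
  \sum_(x <- signed_subseqs s) x.1 *: B (nseq k (\sum_(i <- x.2) w i)).
Proof.
move=> sk; have := @polarization_gen w s [::] k 0 (erefl _).
rewrite sk leqnn eqxx => /(_ isT) <- /=.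
by apply: eq_bigr => x _; rewrite add0r.
Qed.

End Polarization.

Section IteratedDerivativeSymmetric.
Context (R : realType) (E F : lcsType R) (A : set E) (f : E -> F) (r : smoothness).
Hypotheses (oA : open A) (fr : Cr_open A r f).

Lemma iter_dderive_eq vs (g h : E -> F) : (forall x, A x -> g x = h x) ->
  forall x, A x -> iter_dderive vs g x = iter_dderive vs h x.
Proof.
elim: vs g h => [//|v vs IH] g h gh x Ax; apply: IH => // y Ay.
rewrite /dderive; congr (xget _ _); apply/funext => l; apply/propext.
have nA : nbhs y A by exact: open_nbhs_nbhs.
split; apply: is_dderive_near; apply: (@filterS _ (nbhs y) _ _ _ _ nA) => z Az.
  exact: gh.
by rewrite gh.
Qed.

Lemma dirs_nth (vs : seq E) :
  dirs ((fun i : 'I_(size vs) => nth 0 vs i) : {ptws 'I_(size vs) -> E}) = vs.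
Proof.
rewrite /dirs; apply: (@eq_from_nth _ 0); first by rewrite size_map size_enum_ord.
move=> i; rewrite size_map size_enum_ord => ivs.
by rewrite (nth_map (Ordinal ivs)) ?size_enum_ord// nth_enum_ord.
Qed.

Lemma iter_dderivable_seq vs : le_smoothness (size vs) r -> iter_dderivable A vs f.
Proof.
by move=> vr; have [/(_ (fun i => nth 0 vs i))] := fr vr; rewrite dirs_nth.
Qed.

Lemma iter_dderive_continuous vs : le_smoothness (size vs) r ->
  {within A, continuous (iter_dderive vs f)}.
Proof.
move=> vr; have [_ cf] := fr vr.
pose w : {ptws 'I_(size vs) -> E} := fun i => nth 0 vs i.
apply: (@within_continuous_eq _ _ _
  ((iter_diff (@dirs R E (size vs)) f) \o (fun x => (x, w)))).
  by move=> x Ax; rewrite /iter_diff /= dirs_nth.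
apply: (within_continuous_comp _ cf); last by move=> x Ax; split.
apply: continuous_subspaceT; apply: continuous_pair.
  by move=> z; exact: cvg_id.
by move=> z; exact: cvg_cst.
Qed.

Lemma is_dderive_iter vs v x : le_smoothness (size vs).+1 r -> A x ->
  is_dderive (iter_dderive vs f) v x (iter_dderive (rcons vs v) f x).
Proof.
rewrite -(size_rcons vs v) => /iter_dderivable_seq /iter_dderivable_rcons.
move=> [_ /(_ x) d] Ax.
by rewrite iter_dderive_rcons; exact/dderivableP/d.
Qed.

Lemma iter_dderive_swap p a b q x : le_smoothness (size (p ++ [:: a, b & q])) r ->
  A x ->
  iter_dderive (p ++ [:: a, b & q]) f x = iter_dderive (p ++ [:: b, a & q]) f x.
Proof.
move=> sr Ax.
have cat2 (u v : E) : iter_dderive (p ++ [:: u, v & q]) f =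
    iter_dderive q (iter_dderive (rcons (rcons p u) v) f).
  by rewrite -!cat_rcons /iter_dderive foldl_cat.
rewrite !cat2; apply: iter_dderive_eq Ax => y Ay.
have s2 : le_smoothness (size p).+2 r.
  by apply: le_smoothnessW sr; rewrite size_cat /= !addnS !ltnS leq_addr.
have s1 : le_smoothness (size p).+1 r by exact: le_smoothnessW s2.
rewrite [in RHS]iter_dderive_rcons; apply/esym/dderiveE.
apply: (@schwarz R E F A (iter_dderive p f) (iter_dderive (rcons p a) f)
  (iter_dderive (rcons p b) f) (iter_dderive (rcons (rcons p a) b) f) a b) => //.
- by move=> z Az; exact: is_dderive_iter.
- by move=> z Az; exact: is_dderive_iter.
- by move=> z Az; apply: is_dderive_iter => //; rewrite size_rcons.
- apply: (open_within_continuous oA) Ay.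
  by apply: iter_dderive_continuous; rewrite !size_rcons.
Qed.

Lemma iter_dderiveD vs a b x : le_smoothness (size vs).+1 r -> A x ->
  iter_dderive (rcons vs (a + b)) f x =
  iter_dderive (rcons vs a) f x + iter_dderive (rcons vs b) f x.
Proof.
move=> sr Ax; rewrite [in LHS]iter_dderive_rcons; apply: dderiveE.
apply: (@is_dderiveD R E F A (iter_dderive vs f)
  (iter_dderive (rcons vs b) f)) => //.
- exact: is_dderive_iter.
- by move=> z Az; exact: is_dderive_iter.
- apply: (open_within_continuous oA) Ax.
  by apply: iter_dderive_continuous; rewrite !size_rcons.
Qed.

Lemma iter_dderive_polarization k (w : {ptws 'I_k -> E}) x :
  le_smoothness k r -> A x ->
  iter_dderive (dirs w) f x =
  \sum_(y <- signed_subseqs R (enum 'I_k)) ((k`!%:R)^-1 * y.1) *: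
    iter_dderive (dirs ((fun=> \sum_(i <- y.2) w i) : {ptws 'I_k -> E})) f x.
Proof.
move=> kr Ax.
have := @polarization R E F 'I_k (fun vs => iter_dderive vs f x) k _ _ w
  (enum 'I_k).
rewrite size_enum_ord => /(_ _ _ erefl) H.
have {}H : iter_dderive (dirs w) f x *+ k`! =
    \sum_(y <- signed_subseqs R (enum 'I_k)) y.1 *:
      iter_dderive (nseq k (\sum_(i <- y.2) w i)) f x.
  apply: H.
  - apply: adjacent_swap_perm => p a b q pk.
    by apply: iter_dderive_swap => //; rewrite pk.
  - by move=> vs a b vk; apply: iter_dderiveD => //; rewrite vk.
have k0 : (k`!%:R : R) != 0 by rewrite pnatr_eq0 -lt0n fact_gt0.
apply: (@scalerI _ _ (k`!%:R)) => //; rewrite scaler_nat H scaler_sumr.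
apply: eq_bigr => y _; rewrite scalerA mulrA mulfV// mul1r.
congr (_ *: iter_dderive _ f x).
rewrite /dirs; apply: (@eq_from_nth _ 0).
  by rewrite size_nseq size_map size_enum_ord.
move=> i; rewrite size_nseq => ik; rewrite nth_nseq ik.
by rewrite (nth_map (Ordinal ik)) ?size_enum_ord.
Qed.

End IteratedDerivativeSymmetric.

Lemma tvs_cvg_sum (R : realType) (E : tvsType R) (Q : Type) (G : set_system Q)
    {FG : Filter G} (I : Type) (s : seq I) (f : I -> Q -> E) (l : I -> E) :
  (forall i, f i @ G --> l i) ->
  \sum_(i <- s) f i q @[q --> G] --> \sum_(i <- s) l i.
Proof.
move=> fl; elim: s => [|i s IH].
  rewrite big_nil; apply: cvg_trans (@cvg_cst _ (0 : E) _ G _).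
  by apply: near_eq_cvg; apply: nearW => q; rewrite big_nil.
rewrite big_cons; apply: cvg_trans (tvs_cvgD (fl i) IH).
by apply: near_eq_cvg; apply: nearW => q; rewrite big_cons.
Qed.

Lemma sum_continuous (X : topologicalType) (R : realType) (F : lcsType R)
    (I : Type) (s : seq I) (A : set X) (f : I -> X -> F) :
  (forall i, {within A, continuous (f i)}) ->
  {within A, continuous (fun x => \sum_(i <- s) f i x)}.
Proof.
move=> cf; apply/subspace_continuousP => x Ax; apply: tvs_cvg_sum => i.
exact: (iffLR (subspace_continuousP A (f i)) (cf i) x Ax).
Qed.

Lemma scale_within_continuous (X : topologicalType) (R : realType) (F : lcsType R)
    (A : set X) (c : R) (f : X -> F) : {within A, continuous f} ->
  {within A, continuous (fun x => c *: f x)}.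
Proof.
move=> cf; apply/subspace_continuousP => x Ax.
apply: (@tvs_cvgZ _ _ _ _ _ (fun=> c)); first exact: cvg_cst.
exact: (iffLR (subspace_continuousP A f) cf x Ax).
Qed.

Lemma ptws_sum_continuous (R : realType) (E : lcsType R) k (s : seq 'I_k) :
  continuous (fun w : {ptws 'I_k -> E} => \sum_(i <- s) w i).
Proof.
move=> w; apply: (@tvs_cvg_sum R E _ (nbhs w) (nbhs_filter w)) => i.
exact: (@ptws_eval_continuous 'I_k E i w).
Qed.

Lemma cst_ptws_continuous (X : topologicalType) (I : Type) (Y : uniformType)
    (h : X -> Y) :
  continuous h -> continuous ((fun x => fun=> h x) : X -> {ptws I -> Y}).
Proof. by move=> ch; apply: ptws_continuous => i. Qed.

(** At interior points this is polarization of iterated derivatives; both sides are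
   continuous on U x E^k, so the identity extends to the boundary. *)
Lemma dk_polarization (R : realType) (E F : lcsType R) (U : set E) r (f : E -> F) k
    x (w : {ptws 'I_k -> E}) :
  dense_interior U -> Cr_on U r f -> le_smoothness k r -> U x ->
  dk U f (x, w) = \sum_(y <- signed_subseqs R (enum 'I_k)) ((k`!%:R)^-1 * y.1) *:
    dk U f (x, (fun=> \sum_(i <- y.2) w i) : {ptws 'I_k -> E}).
Proof.
move=> dU fr kr Ux; have [fo fe _] := fr.
have [ce ee] := cont_extP (fe k kr).
pose G (z : E * {ptws 'I_k -> E}) :=
  \sum_(y <- signed_subseqs R (enum 'I_k)) ((k`!%:R)^-1 * y.1) *:
    dk U f (z.1, (fun=> \sum_(i <- y.2) z.2 i) : {ptws 'I_k -> E}).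
have : is_diff_ext (@dirs R E k) U° U f G.
  split.
    apply: sum_continuous => y; apply: scale_within_continuous.
    apply: (@within_continuous_comp (E * {ptws 'I_k -> E})%type
      (E * {ptws 'I_k -> E})%type F (U `*` setT) (U `*` setT)
      (fun z => (z.1, (fun=> \sum_(i <- y.2) z.2 i) : {ptws 'I_k -> E}))
      (dk U f)) => //.
      apply: continuous_subspaceT; apply: continuous_pair.
        exact: continuous_fst.
      apply: cst_ptws_continuous.
      apply: (@continuous_comp_total (E * {ptws 'I_k -> E})%type _ _ snd
        (fun w : {ptws 'I_k -> E} => \sum_(i <- y.2) w i)).
        exact: continuous_snd.
      exact: ptws_sum_continuous.
  move=> [z w'] /set_mem [/= Uz _].
  rewrite /iter_diff /= (iter_dderive_polarization (@open_interior _ U) fo)//.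
  apply: eq_bigr => y _; congr (_ *: _).
  by rewrite /dk /diff_ext ee// inE.
move=> /(cont_ext_unique (setXT_sub (@interior_subset _ U))
  (@setXT_dense _ _ _ _ dU) (conj ce ee)) /(_ (x, w)).
by apply; rewrite inE.
Qed.

(** * Uncurrying: joint continuity from compact sets *)

(** The definition of a k-space involves all compact subsets K of X, while here only
   those inside O are given; but in the compact Hausdorff space K each point of O has
   a closed neighbourhood inside O. *)
Lemma k_space_within_continuous (X Y : topologicalType) (O : set X) (a : X -> Y) :
  k_space X -> open O ->
  (forall K, compact K -> K `<=` O -> {within K, continuous a}) ->
  {within O, continuous a}.
Proof.
move=> [hX kX] oO aK.
have sep (K : set X) x : compact K -> O x -> exists2 B, nbhs x B &
    forall y, K y -> closure B y -> O y.
  move=> cK Ox.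
  (* G makes sets B range over ever smaller neighbourhoods of x, so that a finite
     cover of K minus O yields one B whose closure avoids all of it. *)
  pose G := filter_from (nbhs x) (fun B => [set B' | B' `<=` B]).
  have FG : Filter G.
    apply: filter_from_filter; first by exists setT; exact: filterT.
    move=> A B nA nB; exists (A `&` B); first exact: filterI.
    by move=> C CAB; split => z /CAB [].
  have cKO : compact (K `\` O).
    by apply: compact_closedI => //; exact: open_closedC.
  have := @compact_nearW _ _ G (K `\` O) (fun B y => ~ closure B y) FG cKO.
  case.
    move=> y [Ky Oy].
    have xy : x != y by apply/eqP => xy; apply: Oy; rewrite -xy.
    have := hX; rewrite open_hausdorff => /(_ x y xy) [[A B]] /=.
    move=> [/set_mem Ax /set_mem By] [oA oB AB].
    exists (B, [set C | C `<=` A]).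
      split => /=; first exact: open_nbhs_nbhs.
      by exists A => //; exact: open_nbhs_nbhs.
    move=> [y' C] /= [By' CA] _ clC.
    have [z [Cz Bz]] := clC B (open_nbhs_nbhs (conj oB By')).
    have : (A `&` B) z by split => //; exact: CA.
    by rewrite (eqP AB).
  move=> B nB BP; exists B => // y Ky clB; apply: contrapT => Oy.
  exact: (BP B (@subset_refl _ B) y (conj Ky Oy)).
apply/subspace_continuousP => x Ox N; rewrite nbhsE => -[W [oW Wax] WN].
suff oS : open (O `&` a @^-1` W).
  have : nbhs x (O `&` a @^-1` W) by exact: open_nbhs_nbhs.
  by apply: (@filterS _ (nbhs x)) => y [Oy Wy] _; exact: WN.
apply/kX => K cK; rewrite openE => k [/= Ok Wk].
have [B nB KB] := sep K (set_val k) cK Ok.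
have cN : compact (K `&` closure B).
  by apply: compact_closedI => //; exact: closed_closure.
have cont := aK _ cN _.
have NO : K `&` closure B `<=` O by move=> y [Ky By]; exact: KB.
have Nk : (K `&` closure B) (set_val k).
  by split; [exact: set_valP|apply: subset_closure; exact: nbhs_singleton].
have nW : nbhs (a (set_val k)) W by exact: open_nbhs_nbhs.
have nZ := iffLR (subspace_continuousP _ a) (cont NO) _ Nk _ nW.
rewrite /interior /=.
have nk : nbhs k (set_val @^-1` (B `&` [set y | (K `&` closure B) y -> W (a y)])).
  apply: (@set_val_continuous X K k).
  exact: (@filterI _ (nbhs (set_val k)) _ _ _ nB nZ).
apply: (@filterS _ (nbhs k) _ _ _ _ nk) => k' [/= Bk' Zk'].
have Nk' : (K `&` closure B) (set_val k').
  by split; [exact: set_valP|exact: subset_closure].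
by split; [exact: NO|exact: Zk'].
Qed.

Section CompactLift.
Context (X Y : topologicalType) (A : set X).

Definition lift_pair : A * Y -> X * Y := fun z => (set_val z.1, z.2).

Lemma lift_pair_ex z : A z.1 -> exists z', lift_pair z' = z.
Proof. by case: z => x y /= Ax; exists (exist _ x (mem_set Ax), y). Qed.

Lemma nbhs_lift_pair (z : A * Y) (P : set (A * Y)) : nbhs z P ->
  exists2 Q, nbhs (lift_pair z) Q & forall z', Q (lift_pair z') -> P z'.
Proof.
case: z => a y [[P1 P2] /= [nP1 nP2] P12].
case: nP1 => C [[D oD <-] /= Da CP].
exists (D `*` P2).
  by exists (D, P2) => //; split => //=; apply: open_nbhs_nbhs; split.
by move=> [a' y'] /= [Da' P2y']; apply: P12; split => //=; exact: CP.
Qed.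

(** A filter on A whose image in X has a cluster point in A clusters at that point,
   because A carries the topology induced by X. *)
Lemma compact_lift (L : set (X * Y)) : L `<=` A `*` setT -> compact L ->
  compact (lift_pair @^-1` L).
Proof.
move=> LA cL F PF FL.
have [[x y] [Lxy clu]] := cL (lift_pair @ F) _ FL.
have [/= Ax _] := LA _ Lxy.
exists (exist _ x (mem_set Ax), y); split; first exact: Lxy.
move=> P Q FP /nbhs_lift_pair [Q' nQ' Q'Q].
have FP' : (lift_pair @ F) (lift_pair @` P).
  by apply: (@filterS _ F _ _ _ _ FP) => z Pz; exists z.
have [_ [[z Pz <-] Q'z]] := clu _ _ FP' nQ'.
by exists z; split => //; exact: Q'Q.
Qed.

End CompactLift.

Section EvalContinuous.
Context (R : realType) (E F : lcsType R) (s : smoothness) (M : manifold E).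

Lemma Cr_eval_near (h : Cr s M F) (i : Cr_index s M) (K : set (Cr_op_dom i)) x A :
  compact K -> nbhs (Cr_op h x) A ->
  \forall x' \near x & g \near h, K x' -> A (Cr_op (i := i) g x').
Proof.
exact: (@initial_lcs_eval_near R F _ _ _ _ (@Cr_op_linear R E s M F)
  (@Cr_op_continuous R E s M F) (@Cr_op_injective R E s M F)).
Qed.

(** Cr_eval_near for subsets of the modelling space in place of subtypes, which is how
   compact sets arise as images of compact sets. *)
Lemma dk_eval_cvg (psi : chart E M) (apsi : maximal_atlas psi) j
    (js : le_smoothness j s) (Q : Type) (G : set_system Q) {FG : Filter G}
    (a : Q -> Cr s M F) (b : Q -> E * {ptws 'I_j -> E}) (h : Cr s M F)
    (q : E * {ptws 'I_j -> E})
    (L : set (E * {ptws 'I_j -> E})) :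
  compact L -> L `<=` chart_cod psi `*` setT -> L q ->
  a @ G --> h -> b @ G --> q -> (\forall t \near G, L (b t)) ->
  @dk R E F (chart_cod psi) j (a t \o chart_inv psi) (b t) @[t --> G] -->
  @dk R E F (chart_cod psi) j (h \o chart_inv psi) q.
Proof.
move=> cL LV Lq ah bq Lb N nN.
have [Vq _] := LV _ Lq.
have [q' q'E] : exists q' : Cr_op_dom (cr_index apsi js), lift_pair q' = q.
  exact: lift_pair_ex.
have nN' : nbhs (Cr_op (i := cr_index apsi js) h q') N.
  by rewrite /Cr_op /= -/(lift_pair q') q'E.
have [[P H] [/= nP nH] PH] :=
  Cr_eval_near (i := cr_index apsi js) (compact_lift LV cL) nN'.
have [P' nP' PP'] := nbhs_lift_pair nP.
rewrite q'E in nP'.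
have Gall := @filterI _ G FG _ _ (@filterI _ G FG _ _ (ah _ nH) (bq _ nP')) Lb.
suff : G [set t | N (dk (chart_cod psi) (a t \o chart_inv psi) (b t))] by [].
apply: (@filterS _ G _ _ _ _ Gall) => t [[Ht Pt] Lt].
have [Vt _] := LV _ Lt.
have [t' t'E] : exists t' : Cr_op_dom (cr_index apsi js), lift_pair t' = b t.
  exact: lift_pair_ex.
have := PH (t', a t); rewrite /= /Cr_op /= -/(lift_pair t') t'E; apply => //.
split => //; apply: PP'; by rewrite t'E.
Qed.

End EvalContinuous.

Lemma locally_compact_nbhs (X : topologicalType) (O : set X) x :
  hausdorff_space X -> locally_compact [set: X] -> open O -> O x ->
  exists N, [/\ nbhs x N, compact N & N `<=` O].
Proof.
move=> hX lX oO Ox.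
have [W Wx [cW clW]] := lX x I.
have nW : nbhs x W by apply: (@filterS _ (nbhs x) _ _ _ _ Wx) => y; exact.
have [B nB BO] := compact_regular hX cW nW (open_nbhs_nbhs (conj oO Ox)).
exists (W `&` closure B); split.
- apply: filterI => //; apply: (@filterS _ (nbhs x) _ _ _ _ nB).
  exact: subset_closure.
- by apply: compact_closedI => //; exact: closed_closure.
- by move=> y [_ /BO].
Qed.

Section LocallyCompactManifold.
Context (R : realType) (E : lcsType R) (M : manifold E).
Hypothesis lM : locally_compact [set: M].
Variable psi : chart E M.

Lemma chart_compact_nbhs y : chart_cod psi y ->
  exists L, [/\ compact L, L `<=` chart_cod psi
    & within (chart_cod psi) (nbhs y) L].
Proof.
move=> Vy; have my := chart_inv_dom Vy.
have [N [nN cN Ndom]] := locally_compact_nbhs (@manifold_hausdorff _ _ M) lM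
  (@chart_dom_open _ _ _ psi) my.
exists (psi @` N); split.
- apply: continuous_compact cN; apply: continuous_subspaceW Ndom _.
  exact: chart_map_continuous.
- by move=> _ [m Nm <-]; exact/chart_map_cod/Ndom.
- have := iffLR (subspace_continuousP _ _) (@chart_inv_continuous _ _ _ psi) y Vy
    _ nN.
  rewrite /within /=; apply: (@filterS _ (nbhs y)) => y' Ny' Vy'.
  by exists (chart_inv psi y'); [exact: Ny'|exact: chart_invK].
Qed.

(** Translating a compact neighbourhood of an interior point of the chart shows
   that the modelling space is itself locally compact. *)
Lemma model_compact_nbhs y (v : E) : chart_cod psi y ->
  exists2 C, nbhs v C & compact C.
Proof.
move=> Vy.
have [y0 [Vy0 _]] := chart_cod_dense_interior Vy (filterT : nbhs y setT).
have [L [cL LV nL]] := chart_compact_nbhs (interior_subset Vy0).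
have {}nL : nbhs y0 L.
  apply: (@filterS _ (nbhs y0) _ _ _ _ (@filterI _ (nbhs y0) _ _ _ nL Vy0)).
  by move=> y' [+ Vy']; exact.
exists ((fun u => u + (v - y0)) @` L).
  have ct : u + (y0 - v) @[u --> v] --> y0.
    rewrite -[X in _ --> X](subrKC v).
    by apply: tvs_cvgD; [exact: cvg_id|exact: cvg_cst].
  apply: (@filterS _ (nbhs v) _ _ _ _ (ct _ nL)) => u Lu.
  by exists (u + (y0 - v)) => //; rewrite -addrA subrKA subrr addr0.
apply: continuous_compact cL; apply: continuous_subspaceT => u.
by apply: tvs_cvgD; [exact: cvg_id|exact: cvg_cst].
Qed.

End LocallyCompactManifold.

Section Uncurry.
Context (R : realType) (E1 E2 F : lcsType R) (r s : smoothness).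
Context (M1 : manifold E1) (M2 : manifold E2).

Lemma cst_ptws_cvg (Q : Type) (G : set_system Q) {FG : Filter G} (I : Type)
    (Y : uniformType) (h : Q -> Y) (y : Y) : h @ G --> y ->
  ((fun q => fun=> h q) : Q -> {ptws I -> Y}) @ G --> ((fun=> y) : {ptws I -> Y}).
Proof.
move=> hy; apply: (cvg_comp h (fun z => (fun=> z) : {ptws I -> Y}) hy).
by apply: (@cst_ptws_continuous Y I Y id) => z; exact: cvg_id.
Qed.

Lemma dk_linear (psi : chart E2 M2) (apsi : maximal_atlas psi) j
    (js : le_smoothness j s) y (v : {ptws 'I_j -> E2}) (a : R) (h k : Cr s M2 F) :
  chart_cod psi y ->
  dk (chart_cod psi) ((a *: h + k : Cr s M2 F) \o chart_inv psi) (y, v) =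
  a *: dk (chart_cod psi) (h \o chart_inv psi) (y, v) +
  dk (chart_cod psi) (k \o chart_inv psi) (y, v).
Proof.
move=> Vy.
have [q qE] := @lift_pair_ex E2 {ptws 'I_j -> E2} (chart_cod psi) (y, v) Vy.
have := @Cr_op_linear R E2 s M2 F (cr_index apsi js) a h k q.
by rewrite /Cr_op /= -/(lift_pair q) qE.
Qed.

Lemma dk_ZB (psi : chart E2 M2) (apsi : maximal_atlas psi) j
    (js : le_smoothness j s) y (v : {ptws 'I_j -> E2}) (a : R) (h k : Cr s M2 F) :
  chart_cod psi y ->
  dk (chart_cod psi) ((a *: (h - k) : Cr s M2 F) \o chart_inv psi) (y, v) =
  a *: (dk (chart_cod psi) (h \o chart_inv psi) (y, v) -
  dk (chart_cod psi) (k \o chart_inv psi) (y, v)).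
Proof.
move=> Vy.
have [q qE] := @lift_pair_ex E2 {ptws 'I_j -> E2} (chart_cod psi) (y, v) Vy.
have := opsZB (@Cr_op_linear R E2 s M2 F) (i := cr_index apsi js) a h k q.
by rewrite /Cr_op /= -/(lift_pair q) qE.
Qed.

Lemma dk_sum (psi : chart E2 M2) (apsi : maximal_atlas psi) j
    (js : le_smoothness j s) y (v : {ptws 'I_j -> E2}) (I : Type) (l : seq I)
    (a : I -> R) (h : I -> Cr s M2 F) : chart_cod psi y ->
  dk (chart_cod psi) ((\sum_(i <- l) a i *: h i : Cr s M2 F) \o chart_inv psi)
    (y, v) =
  \sum_(i <- l) a i *: dk (chart_cod psi) (h i \o chart_inv psi) (y, v).
Proof.
move=> Vy; elim: l => [|i l IH].
  rewrite !big_nil; have := dk_linear apsi js v (-1) 0 0 Vy.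
  by rewrite scaler0 addr0 scaleN1r addNr.
by rewrite !big_cons dk_linear// IH.
Qed.

(** Derivatives in C^s(M2, F) are mapped to derivatives in F by the continuous linear
   functionals that evaluate a derivative at a point. *)
Lemma is_dderive_dk (psi : chart E2 M2) (apsi : maximal_atlas psi) j
    (js : le_smoothness j s) y (v : {ptws 'I_j -> E2})
    (a : E1 -> Cr s M2 F) u x l : chart_cod psi y ->
  is_dderive a u x l ->
  is_dderive (fun x => dk (chart_cod psi) (a x \o chart_inv psi) (y, v)) u x
    (dk (chart_cod psi) (l \o chart_inv psi) (y, v)).
Proof.
move=> Vy al; rewrite /is_dderive.
under eq_fun do rewrite -(dk_ZB apsi js)//.
apply: (@dk_eval_cvg R E2 F s M2 psi apsi j js R ((0 : R)^') _
  (fun t => t^-1 *: (a (x + t *: u) - a x)) (fun=> (y, v)) l (y, v)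
  [set (y, v)]) => //.
- exact: compact_set1.
- by move=> _ ->; split.
- exact: cvg_cst.
- by apply: nearW.
Qed.

Variable g : M1 -> Cr s M2 F.
Hypothesis gC : is_Cr r g.
Variables (phi : chart E1 M1) (aphi : maximal_atlas phi).
Variables (psi : chart E2 M2) (apsi : maximal_atlas psi).
Local Notation U := (chart_cod phi).
Local Notation V := (chart_cod psi).
Let dU : dense_interior U := @chart_cod_dense_interior _ _ _ phi.
Let dV : dense_interior V := @chart_cod_dense_interior _ _ _ psi.
Let jet := Cr_on_jet (gC aphi).

(** The candidate for the (i, j)-th derivative of the uncurried map. *)
Definition uncurry_dij i j
    (z : (E1 * E2) * ({ptws 'I_i -> E1} * {ptws 'I_j -> E2})) : F :=
  @dk R E2 F V j (@dk R E1 (Cr s M2 F) U i (g \o chart_inv phi) (z.1.1, z.2.1)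
    \o chart_inv psi) (z.1.2, z.2.2).
Arguments uncurry_dij : clear implicits.

Let f (p : M1 * M2) := g p.1 p.2.

Lemma uncurry_jet :
  (forall i j, le_smoothness i r -> le_smoothness j s ->
    {within (U `*` V) `*` setT, continuous (uncurry_dij i j)}) ->
  Crs_jet U V r s uncurry_dij (f \o chart_inv2 phi psi).
Proof.
move=> ce; have [_ g0 gS] := jet; split => //.
- move=> [x y] [w v] [/= Ux Vy]; rewrite /uncurry_dij /= g0//.
  by have [_ h0 _] := Cr_on_jet (CrP (g (chart_inv phi x)) apsi); rewrite h0.
- move=> j js [x y] w v [/= Ux Vy].
  apply/(@is_dderive_snd _ _ _ _
    (fun z => uncurry_dij 0 j (z, (w, init_dirs v)))).
  have [_ _ hS] := Cr_on_jet
    (CrP (@dk R E1 (Cr s M2 F) U 0 (g \o chart_inv phi) (x, w)) apsi).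
  exact: hS.
- move=> i j ir js [x y] w v [/= Ux Vy].
  apply/(@is_dderive_fst _ _ _ _
    (fun z => uncurry_dij i j (z, (init_dirs w, v)))).
  apply: (is_dderive_dk apsi js (a := fun x =>
    @dk R E1 (Cr s M2 F) U i (g \o chart_inv phi) (x, init_dirs w))).
    exact: interior_subset.
  exact: gS.
Qed.

(** The values of b are confined to a compact set L because this is where evaluation
   on C^s(M2, F) is jointly continuous. *)
Lemma uncurry_dij_cvg i j (ir : le_smoothness i r) (js : le_smoothness j s)
    (Q : Type) (G : set_system Q) {FG : Filter G}
    (a : Q -> E1 * {ptws 'I_i -> E1}) (b : Q -> E2 * {ptws 'I_j -> E2})
    (p : E1 * {ptws 'I_i -> E1}) (q : E2 * {ptws 'I_j -> E2})
    (L : set (E2 * {ptws 'I_j -> E2})) :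
  a @ G --> p -> b @ G --> q -> U p.1 -> (\forall t \near G, U (a t).1) ->
  compact L -> L `<=` V `*` setT -> L q -> (\forall t \near G, L (b t)) ->
  uncurry_dij i j (((a t).1, (b t).1), ((a t).2, (b t).2)) @[t --> G] -->
  uncurry_dij i j ((p.1, q.1), (p.2, q.2)).
Proof.
move=> ap bq Up Ua cL LV Lq Lb; have [cg _ _] := jet.
rewrite /uncurry_dij /= -!surjective_pairing.
under eq_fun do rewrite -!surjective_pairing.
apply: (dk_eval_cvg apsi js cL LV Lq) => //.
apply: (within_cvg (cg i ir)) => //.
by apply: (@filterS _ G _ _ _ _ Ua) => t Ut; split.
Qed.

Definition uncurry_diag i j (z : (E1 * E2) * (E1 * E2)) : F :=
  uncurry_dij i j (z.1, (fun=> z.2.1, fun=> z.2.2)).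
Arguments uncurry_diag : clear implicits.

(** Polarization in both groups of directions reduces the joint continuity of the
   iterated derivatives to directions that agree within each group; this is what
   makes k-space conditions on products with a single factor E1 or E2 suffice. *)
Lemma uncurry_dij_continuous i j : le_smoothness i r -> le_smoothness j s ->
  {within (U `*` V) `*` setT, continuous (uncurry_diag i j)} ->
  {within (U `*` V) `*` setT, continuous (uncurry_dij i j)}.
Proof.
move=> ir js cd.
pose cr k (y : R * seq 'I_k) : R := (k`!%:R)^-1 * y.1.
apply: (@within_continuous_eq
  ((E1 * E2) * ({ptws 'I_i -> E1} * {ptws 'I_j -> E2}))%type F _ (fun z =>
  \sum_(a <- signed_subseqs R (enum 'I_i)) cr i a *:
  \sum_(b <- signed_subseqs R (enum 'I_j)) cr j b *:
    uncurry_diag i j (z.1, (\sum_(k <- a.2) z.2.1 k, \sum_(k <- b.2) z.2.2 k)))).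
  move=> [[x y] [w v]] [[/= Ux Vy] _]; rewrite /uncurry_dij /=.
  rewrite (dk_polarization w dU (gC aphi) ir Ux) (dk_sum apsi js)//.
  apply: eq_bigr => a _; congr (_ *: _).
  by rewrite (dk_polarization v dV (CrP _ apsi) js Vy).
apply: sum_continuous => a; apply: scale_within_continuous.
apply: sum_continuous => b; apply: scale_within_continuous.
apply: (@within_continuous_comp _ ((E1 * E2) * (E1 * E2))%type F _ ((U `*` V) `*` setT)
  (fun z : (E1 * E2) * ({ptws 'I_i -> E1} * {ptws 'I_j -> E2}) =>
   (z.1, (\sum_(k <- a.2) z.2.1 k, \sum_(k <- b.2) z.2.2 k)))
  (uncurry_diag i j)) => //.
apply: continuous_subspaceT; apply: continuous_pair; first exact: continuous_fst.
apply: continuous_pair.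
- apply: (continuous_comp_total (f := fun z => z.2.1)
    (g := fun w : {ptws 'I_i -> E1} => \sum_(k <- a.2) w k)); last first.
    exact: ptws_sum_continuous.
  exact: (continuous_comp_total (@continuous_snd _ _) (@continuous_fst _ _)).
- apply: (continuous_comp_total (f := fun z => z.2.2)
    (g := fun w : {ptws 'I_j -> E2} => \sum_(k <- b.2) w k)); last first.
    exact: ptws_sum_continuous.
  exact: (continuous_comp_total (@continuous_snd _ _) (@continuous_snd _ _)).
Qed.

End Uncurry.

Section UncurryDiagonal.
Context (R : realType) (E1 E2 F : lcsType R) (r s : smoothness).
Context (M1 : manifold E1) (M2 : manifold E2).
Variable g : M1 -> Cr s M2 F.
Hypothesis gC : is_Cr r g.
Variables (phi : chart E1 M1) (aphi : maximal_atlas phi).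
Variables (psi : chart E2 M2) (apsi : maximal_atlas psi).
Local Notation U := (chart_cod phi).
Local Notation V := (chart_cod psi).
Variables (i j : nat) (ir : le_smoothness i r) (js : le_smoothness j s).

Let Z := ((E1 * E2) * (E1 * E2))%type.

(** X stands for the product of M1 and M2 with those of the factors E1, E2 on which
   derivatives of order (i, j) depend: q1 only has to give back the direction in E1
   up to the equality of the i-tuples made from it, which is vacuous for i = 0. *)
Lemma uncurry_diag_k_space (X : topologicalType) (p1 : X -> M1) (p2 : X -> M2)
    (q1 : X -> E1) (q2 : X -> E2) (sigma : (M1 * M2) * (E1 * E2) -> X) :
  k_space X ->
  continuous p1 -> continuous p2 -> continuous q1 -> continuous q2 ->
  continuous sigma ->
  (forall z, p1 (sigma z) = z.1.1) -> (forall z, p2 (sigma z) = z.1.2) ->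
  (forall z, (fun=> q1 (sigma z) : E1) = (fun=> z.2.1) :> ('I_i -> E1)) ->
  (forall z, (fun=> q2 (sigma z) : E2) = (fun=> z.2.2) :> ('I_j -> E2)) ->
  {within (U `*` V) `*` setT, continuous (uncurry_diag g phi psi i j)}.
Proof.
move=> kX cp1 cp2 cq1 cq2 cs p1s p2s q1s q2s.
pose O := p1 @^-1` chart_dom phi `&` p2 @^-1` chart_dom psi.
have oO : open O.
  by apply: openI; apply: open_comp (@chart_dom_open _ _ _ _) => x _;
    [exact: cp1|exact: cp2].
pose a x := uncurry_diag g phi psi i j ((phi (p1 x), psi (p2 x)), (q1 x, q2 x)).
have ca : {within O, continuous a}.
  apply: k_space_within_continuous => // K cK KO.
  have c1 : {within K, continuous (fun x => phi (p1 x))}.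
    apply: (within_continuous_comp (continuous_subspaceT cp1)
      (@chart_map_continuous _ _ _ phi)).
    by move=> x /KO [].
  have c2 : {within K, continuous (fun x => psi (p2 x))}.
    apply: (within_continuous_comp (continuous_subspaceT cp2)
      (@chart_map_continuous _ _ _ psi)).
    by move=> x /KO [].
  pose b x : E2 * {ptws 'I_j -> E2} := (psi (p2 x), fun=> q2 x).
  have cb x : K x -> b @ within K (nbhs x) --> b x.
    move=> Kx; apply: pair_cvg.
      exact: (iffLR (subspace_continuousP K _) c2 x Kx).
    apply: cst_ptws_cvg; apply: cvg_trans (cq2 x).
    by apply: cvg_app; exact: cvg_within.
  apply/subspace_continuousP => x Kx.
  apply: (uncurry_dij_cvg gC aphi apsi ir js (L := b @` K)
    (a := fun x => (phi (p1 x), (fun=> q1 x) : {ptws 'I_i -> E1})) (b := b)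
    (p := (phi (p1 x), (fun=> q1 x) : {ptws 'I_i -> E1})) (q := b x)).
  - apply: pair_cvg.
      exact: (iffLR (subspace_continuousP K _) c1 x Kx).
    apply: cst_ptws_cvg; apply: cvg_trans (cq1 x).
    by apply: cvg_app; exact: cvg_within.
  - exact: cb.
  - by apply: chart_map_cod; have [] := KO _ Kx.
  - by apply: (@nearW _ (nbhs x)) => t Kt; apply: chart_map_cod; have [] := KO _ Kt.
  - by apply: continuous_compact cK; apply/subspace_continuousP.
  - by move=> _ [t Kt <-]; split => //; apply: chart_map_cod; have [] := KO _ Kt.
  - by exists x.
  - by apply: (@nearW _ (nbhs x)) => t Kt; exists t.
have aE (z : Z) : ((U `*` V) `*` setT) z ->
    a (sigma ((chart_inv phi z.1.1, chart_inv psi z.1.2), z.2)) =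
    uncurry_diag g phi psi i j z.
  case: z => -[x y] wv [[/= Ux Vy] _].
  by rewrite /a /uncurry_diag /= p1s p2s q1s q2s /= !chart_invK.
apply: (within_continuous_eq aE).
apply: (within_continuous_comp _ ca).
  apply: (within_continuous_comp _ (continuous_subspaceT (A := setT) cs)) => //.
  apply/subspace_continuousP => z [[Ux Vy] Tz].
  apply: pair_cvg; last first.
    by apply: cvg_trans (@continuous_snd _ _ z); apply: cvg_app; exact: cvg_within.
  have cU : {within ((U `*` V) `*` setT : set Z),
      continuous (fun z => chart_inv phi z.1.1)}.
    apply: (within_continuous_comp (h := fun z : Z => z.1.1) _
      (@chart_inv_continuous _ _ _ phi)).
      apply: continuous_subspaceT.
      exact: (continuous_comp_total (@continuous_fst _ _) (@continuous_fst _ _)).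
    by move=> z' [[]].
  have cV : {within ((U `*` V) `*` setT : set Z),
      continuous (fun z => chart_inv psi z.1.2)}.
    apply: (within_continuous_comp (h := fun z : Z => z.1.2) _
      (@chart_inv_continuous _ _ _ psi)).
      apply: continuous_subspaceT.
      exact: (continuous_comp_total (@continuous_fst _ _) (@continuous_snd _ _)).
    by move=> z' [[]].
  apply: pair_cvg.
    exact: (iffLR (subspace_continuousP _ _) cU z).
  exact: (iffLR (subspace_continuousP _ _) cV z).
by move=> z [[Ux Vy] _]; split; rewrite /= ?p1s ?p2s /=; exact: chart_inv_dom.
Qed.

Lemma uncurry_diag_locally_compact : locally_compact [set: M2] ->
  {within (U `*` V) `*` setT, continuous (uncurry_diag g phi psi i j)}.
Proof.
move=> lM; apply/subspace_continuousP => -[[x y] [w v]] [[/= Ux Vy] _].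
have [L [cL LV nL]] := chart_compact_nbhs lM Vy.
have [C nC cC] := model_compact_nbhs lM v Vy.
set G := within _ _.
pose c (z : E2 * E2) : E2 * {ptws 'I_j -> E2} := (z.1, fun=> z.2).
have cz (T : topologicalType) (h : Z -> T) : continuous h ->
    h @ G --> h ((x, y), (w, v)).
  by move=> ch; apply: cvg_trans (ch _); apply: cvg_app; exact: cvg_within.
have c1 : z.1.1 @[z --> G] --> x.
  apply: (cz E1 (fun z => z.1.1)).
  exact: (continuous_comp_total (@continuous_fst _ _) (@continuous_fst _ _)).
have c2 : z.1.2 @[z --> G] --> y.
  apply: (cz E2 (fun z => z.1.2)).
  exact: (continuous_comp_total (@continuous_fst _ _) (@continuous_snd _ _)).
have c3 : z.2.1 @[z --> G] --> w.
  apply: (cz E1 (fun z => z.2.1)).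
  exact: (continuous_comp_total (@continuous_snd _ _) (@continuous_fst _ _)).
have c4 : z.2.2 @[z --> G] --> v.
  apply: (cz E2 (fun z => z.2.2)).
  exact: (continuous_comp_total (@continuous_snd _ _) (@continuous_snd _ _)).
have UV : G [set z : Z | U z.1.1 /\ V z.1.2].
  by apply: (@nearW _ (nbhs (((x, y), (w, v)) : Z))) => z [[]].
have nearL : G [set z : Z | L z.1.2].
  apply: (@filterS _ G _ _ _ _ (@filterI _ G _ _ _ (c2 _ nL) UV)).
  by move=> z [+ []] => /= H _ /H.
suff H : uncurry_dij g phi psi (i := i) (j := j) ((z.1.1, (c (z.1.2, z.2.2)).1),
    ((fun=> z.2.1), (c (z.1.2, z.2.2)).2)) @[z --> G] -->
    uncurry_dij g phi psi (i := i) (j := j) ((x, y), ((fun=> w), (fun=> v))).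
  apply: cvg_trans H; apply: near_eq_cvg; apply: nearW => -[[x' y'] [w' v']].
  by [].
apply: (uncurry_dij_cvg gC aphi apsi ir js (L := c @` (L `*` C))
  (a := fun z : Z => (z.1.1, (fun=> z.2.1) : {ptws 'I_i -> E1}))
  (b := fun z : Z => c (z.1.2, z.2.2))
  (p := (x, (fun=> w) : {ptws 'I_i -> E1})) (q := c (y, v))) => //.
- by apply: pair_cvg => //; exact: cst_ptws_cvg.
- by apply: pair_cvg => //; exact: cst_ptws_cvg.
- by apply: (@filterS _ G _ _ _ _ UV) => z [].
- apply: continuous_compact; last exact: compact_setX.
  apply: continuous_subspaceT; apply: continuous_pair.
    exact: continuous_fst.
  by apply: cst_ptws_continuous; exact: continuous_snd.
- by move=> _ [[y' v'] [/= /LV Vy' _] <-].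
- exists (y, v) => //; split => /=; last exact: nbhs_singleton.
  exact: (nbhs_singleton nL Vy).
- apply: (@filterS _ G _ _ _ _ (@filterI _ G _ _ _ nearL (c4 _ nC))) => z [Lz Cz].
  by exists (z.1.2, z.2.2).
Qed.

End UncurryDiagonal.

(** * The exponential law *)

Section ExponentialLaw.
Context (R : realType) (E1 E2 F : lcsType R).
Context (M1 : manifold E1) (M2 : manifold E2) (r s : smoothness).

Lemma is_Cr_in (E G : lcsType R) (t : smoothness) (M : manifold E) (h : M -> G) :
  is_Cr t h -> h \in @Cr_pred R E t M G.
Proof. by move=> ht; exact: asboolT. Qed.

Lemma is_Crs_in (f : M1 * M2 -> F) :
  is_Crs r s f -> f \in @Crs_pred R E1 E2 r s M1 M2 F.
Proof. by move=> fC; exact: asboolT. Qed.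

(** The identity behind the isomorphism; through Cr_op_curry it also matches the
   operators that define the two topologies. *)
Lemma dk_curry_dij (f : M1 * M2 -> F) (g : M1 -> Cr s M2 F)
    (phi : chart E1 M1) (psi : chart E2 M2) i j x y w v :
  is_Crs r s f -> (forall x y, g x y = f (x, y)) ->
  maximal_atlas phi -> maximal_atlas psi ->
  le_smoothness i r -> le_smoothness j s -> chart_cod phi x -> chart_cod psi y ->
  @dk R E2 F (chart_cod psi) j
    (@dk R E1 (Cr s M2 F) (chart_cod phi) i (g \o chart_inv phi) (x, w)
      \o chart_inv psi) (y, v) =
  @dij R E1 E2 F (chart_cod phi) (chart_cod psi) i j (f \o chart_inv2 phi psi)
    ((x, y), (w, v)).
Proof.
move=> fC gf aphi apsi ir js Ux Vy.
by rewrite (dk_curry fC aphi gf ir (p := (x, w)))// (dk_curry_dkC fC aphi apsi).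
Qed.

Lemma curry_is_Cr (f : M1 * M2 -> F) (g : M1 -> Cr s M2 F) :
  is_Crs r s f -> (forall x y, g x y = f (x, y)) -> is_Cr r g.
Proof. by move=> fC gf phi aphi; exact: (curry_Cr_on fC aphi gf). Qed.

Definition curry_fun (f : Crs r s M1 M2 F) (x : M1) : Cr s M2 F :=
  MkCr (is_Cr_in (is_Crs_snd (CrsP f) x)).

Definition curry (f : Crs r s M1 M2 F) : Cr r M1 (Cr s M2 F) :=
  MkCr (is_Cr_in (curry_is_Cr (g := curry_fun f) (CrsP f) (fun _ _ => erefl))).

Lemma curry_linear : linear curry.
Proof. by move=> a f g; apply/val_inj/funext => x; apply/val_inj/funext => y. Qed.

HB.instance Definition _ := GRing.isLinear.Build R (Crs r s M1 M2 F)
  (Cr r M1 (Cr s M2 F)) *:%R curry curry_linear.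

Section ChartOperators.
Variables (phi : chart E1 M1) (aphi : maximal_atlas phi).
Variables (psi : chart E2 M2) (apsi : maximal_atlas psi).
Variables (i j : nat) (ir : le_smoothness i r) (js : le_smoothness j s).

Definition crs_index : Crs_index r s M1 M2 :=
  ((exist _ phi aphi, exist _ psi apsi),
   (exist (le_smoothness^~ r) i ir, exist (le_smoothness^~ s) j js)).

Definition shuffle
    (z : Cr_op_dom (cr_index aphi ir) * Cr_op_dom (cr_index apsi js)) :
  Crs_op_dom crs_index := ((z.1.1, z.2.1), (z.1.2, z.2.2)).

Lemma shuffle_continuous : continuous shuffle.
Proof.
apply: continuous_pair; apply: continuous_pair.
- exact: (continuous_comp_total (@continuous_fst _ _) (@continuous_fst _ _)).
- exact: (continuous_comp_total (@continuous_snd _ _) (@continuous_fst _ _)).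
- exact: (continuous_comp_total (@continuous_fst _ _) (@continuous_snd _ _)).
- exact: (continuous_comp_total (@continuous_snd _ _) (@continuous_snd _ _)).
Qed.

Lemma Cr_op_curry (f : Crs r s M1 M2 F) (p : Cr_op_dom (cr_index aphi ir))
    (q : Cr_op_dom (cr_index apsi js)) :
  Cr_op (Cr_op (curry f) p) q = Crs_op (a := crs_index) f (shuffle (p, q)).
Proof.
case: p => x w; case: q => y v.
rewrite /Cr_op /Crs_op /=; apply: dk_curry_dij => //; first exact: CrsP.
  exact: set_valP.
exact: set_valP.
Qed.

End ChartOperators.

(** Uniform convergence on K, with values in the functions on L, is uniform
   convergence on K x L. *)
Lemma curry_continuous : continuous curry.
Proof.
move=> f0.
apply: (initial_lcs_cvg (FG := nbhs_filter f0)) => -[[phi aphi] [i ir]] K cK p Kp.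
have FG1 : Filter (filter_prod (nbhs f0) (within K (nbhs p))).
  exact: filter_prod_filter.
apply: (initial_lcs_cvg (FG := FG1)) => -[[psi apsi] [j js]] L cL q Lq.
pose sh := @shuffle phi aphi psi apsi i j ir js.
pose G := filter_prod (filter_prod (nbhs f0) (within K (nbhs p)))
  (within L (nbhs q)).
have H : Crs_op (a := crs_index aphi apsi ir js) z.1.1 (sh (z.1.2, z.2)) @[z --> G]
    --> Crs_op (a := crs_index aphi apsi ir js) f0 (sh (p, q)).
  apply: (@initial_lcs_op_cvg R F _ _ _ _ (@Crs_op_linear R E1 E2 r s M1 M2 F)
    (@Crs_op_continuous R E1 E2 r s M1 M2 F) (@Crs_op_injective R E1 E2 r s M1 M2 F)
    _ G _ (crs_index aphi apsi ir js) (sh @` (K `*` L)) (fun z => z.1.1)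
    (fun z => sh (z.1.2, z.2))).
  - apply: continuous_compact; last exact: compact_setX.
    by apply: continuous_subspaceT; exact: shuffle_continuous.
  - exact: (cvg_comp _ _ cvg_fst cvg_fst).
  - apply: (cvg_comp (fun z => (z.1.2, z.2)) sh _
      (@shuffle_continuous _ _ _ _ _ _ _ _ (p, q))).
    apply: pair_cvg.
      apply: (cvg_comp _ _ cvg_fst (cvg_trans cvg_snd _)).
      exact: cvg_within.
    by apply: (cvg_trans cvg_snd); exact: cvg_within.
  - exists ([set z | K z.2], L); last by move=> z [/= Kz Lz]; exists (z.1.2, z.2).
    split => /=; last by apply: (@nearW _ (nbhs q)).
    exists (setT, K); last by move=> z [].
    by split => /=; [exact: filterT|apply: (@nearW _ (nbhs p))].
rewrite -Cr_op_curry in H.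
apply: cvg_trans H; apply: near_eq_cvg; apply: nearW => z.
by rewrite -Cr_op_curry.
Qed.

(** A compact set K of arguments of e_ij is contained in the product of its
   projections p(K) and q(K), on which the evaluation can be done in two steps. *)
Lemma uncurry_continuous (Psi : Cr r M1 (Cr s M2 F) -> Crs r s M1 M2 F) :
  cancel Psi curry -> continuous Psi.
Proof.
move=> PsiK g0.
apply: (initial_lcs_cvg (FG := nbhs_filter g0)).
move=> -[[[phi aphi] [psi apsi]] [[i ir] [j js]]] K cK z0 Kz0.
pose G := filter_prod (nbhs g0) (within K (nbhs z0)).
pose p (z : Crs_op_dom (crs_index aphi apsi ir js)) :
  Cr_op_dom (cr_index aphi ir) := (z.1.1, z.2.1).
pose q (z : Crs_op_dom (crs_index aphi apsi ir js)) :
  Cr_op_dom (cr_index apsi js) := (z.1.2, z.2.2).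
have pq z : z = shuffle (p z, q z) by case: z => -[x y] [w v].
have cp : continuous p.
  apply: continuous_pair.
    exact: (continuous_comp_total (@continuous_fst _ _) (@continuous_fst _ _)).
  exact: (continuous_comp_total (@continuous_snd _ _) (@continuous_fst _ _)).
have cq : continuous q.
  apply: continuous_pair.
    exact: (continuous_comp_total (@continuous_fst _ _) (@continuous_snd _ _)).
  exact: (continuous_comp_total (@continuous_snd _ _) (@continuous_snd _ _)).
have zG : z.2 @[z --> G] --> z0.
  by apply: (cvg_trans cvg_snd); exact: cvg_within.
have KG : G [set z | K z.2].
  exists (setT, K); last by move=> z [].
  by split => /=; [exact: filterT|apply: (@nearW _ (nbhs z0))].
have H1 : Cr_op z.1 (p z.2) @[z --> G] --> Cr_op g0 (p z0).
  apply: (@initial_lcs_op_cvg R _ _ _ _ _ (@Cr_op_linear R E1 r M1 (Cr s M2 F))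
    (@Cr_op_continuous R E1 r M1 (Cr s M2 F))
    (@Cr_op_injective R E1 r M1 (Cr s M2 F))
    _ G _ (cr_index aphi ir) (p @` K) (fun z => z.1) (fun z => p z.2)).
  - by apply: continuous_compact cK; apply: continuous_subspaceT.
  - exact: cvg_fst.
  - exact: (cvg_comp _ _ zG (cp z0)).
  - by apply: (@filterS _ G _ _ _ _ KG) => z Kz; exists z.2.
have H2 : Cr_op (Cr_op z.1 (p z.2)) (q z.2) @[z --> G] -->
    Cr_op (Cr_op g0 (p z0)) (q z0).
  apply: (@initial_lcs_op_cvg R F _ _ _ _ (@Cr_op_linear R E2 s M2 F)
    (@Cr_op_continuous R E2 s M2 F) (@Cr_op_injective R E2 s M2 F)
    _ G _ (cr_index apsi js) (q @` K) (fun z => Cr_op z.1 (p z.2))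
    (fun z => q z.2)).
  - by apply: continuous_compact cK; apply: continuous_subspaceT.
  - exact: H1.
  - exact: (cvg_comp _ _ zG (cq z0)).
  - by apply: (@filterS _ G _ _ _ _ KG) => z Kz; exists z.2.
have E g z : Crs_op (a := crs_index aphi apsi ir js) (Psi g) z =
    Cr_op (Cr_op g (p z)) (q z).
  by rewrite {1}[z]pq -Cr_op_curry PsiK.
have -> : (fun z => Crs_op (a := crs_index aphi apsi ir js) (Psi z.1) z.2) =
    (fun z => Cr_op (Cr_op z.1 (p z.2)) (q z.2)) by apply/funext => z.
rewrite [X in _ --> X]E.
exact: H2.
Qed.

Hypothesis hyp : locally_compact [set: M2] \/
  [\/ [/\ r = Some 0%N, s = Some 0%N & k_space (M1 * M2)%type],
      [/\ le_smoothness 1 r, s = Some 0%N & k_space (M1 * M2 * E1)%type],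
      [/\ r = Some 0%N, le_smoothness 1 s & k_space (M1 * M2 * E2)%type]
    | [/\ le_smoothness 1 r, le_smoothness 1 s
        & k_space (M1 * M2 * E1 * E2)%type]].

Lemma uncurry_diag_continuous (g : M1 -> Cr s M2 F) (phi : chart E1 M1)
    (psi : chart E2 M2) i j : is_Cr r g -> maximal_atlas phi -> maximal_atlas psi ->
  le_smoothness i r -> le_smoothness j s ->
  {within (chart_cod phi `*` chart_cod psi) `*` setT,
    continuous (uncurry_diag g phi psi i j)}.
Proof.
move=> gC aphi apsi ir js.
have cst0 (E : lcsType R) (u u' : E) k t : le_smoothness k t -> t = Some 0%N ->
    (fun=> u) = (fun=> u') :> ('I_k -> E).
  case: k => [|k] kt tE; last by move: kt; rewrite tE.
  by apply/funext => -[].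
case: hyp => [lM|].
  exact: (uncurry_diag_locally_compact gC aphi apsi ir js lM).
case=> [[r0 s0 kX]|[r1 s0 kX]|[r0 s1 kX]|[r1 s1 kX]].
- apply: (uncurry_diag_k_space gC aphi apsi ir js kX (p1 := fst) (p2 := snd)
    (q1 := fun=> 0) (q2 := fun=> 0) (sigma := fst)) => //.
  + exact: continuous_fst.
  + exact: continuous_snd.
  + by move=> z; exact: cvg_cst.
  + by move=> z; exact: cvg_cst.
  + exact: continuous_fst.
  + by move=> z; exact: cst0 ir r0.
  + by move=> z; exact: cst0 js s0.
- apply: (uncurry_diag_k_space gC aphi apsi ir js kX (p1 := fun z => z.1.1)
    (p2 := fun z => z.1.2) (q1 := snd) (q2 := fun=> 0)
    (sigma := fun z => (z.1, z.2.1))) => //.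
  + exact: (continuous_comp_total (@continuous_fst _ _) (@continuous_fst _ _)).
  + exact: (continuous_comp_total (@continuous_fst _ _) (@continuous_snd _ _)).
  + exact: continuous_snd.
  + by move=> z; exact: cvg_cst.
  + apply: continuous_pair; first exact: continuous_fst.
    exact: (continuous_comp_total (@continuous_snd _ _) (@continuous_fst _ _)).
  + by move=> z; exact: cst0 js s0.
- apply: (uncurry_diag_k_space gC aphi apsi ir js kX (p1 := fun z => z.1.1)
    (p2 := fun z => z.1.2) (q1 := fun=> 0) (q2 := snd)
    (sigma := fun z => (z.1, z.2.2))) => //.
  + exact: (continuous_comp_total (@continuous_fst _ _) (@continuous_fst _ _)).
  + exact: (continuous_comp_total (@continuous_fst _ _) (@continuous_snd _ _)).
  + by move=> z; exact: cvg_cst.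
  + exact: continuous_snd.
  + apply: continuous_pair; first exact: continuous_fst.
    exact: (continuous_comp_total (@continuous_snd _ _) (@continuous_snd _ _)).
  + by move=> z; exact: cst0 ir r0.
- apply: (uncurry_diag_k_space gC aphi apsi ir js kX (p1 := fun z => z.1.1.1)
    (p2 := fun z => z.1.1.2) (q1 := fun z => z.1.2) (q2 := snd)
    (sigma := fun z => ((z.1, z.2.1), z.2.2))) => //.
  + apply: (continuous_comp_total (f := fun z => z.1.1) _ (@continuous_fst _ _)).
    exact: (continuous_comp_total (@continuous_fst _ _) (@continuous_fst _ _)).
  + apply: (continuous_comp_total (f := fun z => z.1.1) _ (@continuous_snd _ _)).
    exact: (continuous_comp_total (@continuous_fst _ _) (@continuous_fst _ _)).
  + exact: (continuous_comp_total (@continuous_fst _ _) (@continuous_snd _ _)).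
  + exact: continuous_snd.
  + apply: continuous_pair; last first.
      exact: (continuous_comp_total (@continuous_snd _ _) (@continuous_snd _ _)).
    apply: continuous_pair; first exact: continuous_fst.
    exact: (continuous_comp_total (@continuous_snd _ _) (@continuous_fst _ _)).
Qed.

Lemma uncurry_is_Crs (g : M1 -> Cr s M2 F) : is_Cr r g ->
  is_Crs r s (fun p : M1 * M2 => g p.1 p.2).
Proof.
move=> gC phi psi aphi apsi.
apply: Crs_jet_on.
- exact: chart_cod_dense_interior.
- exact: chart_cod_dense_interior.
apply: (uncurry_jet gC aphi apsi) => i j ir js.
apply: (uncurry_dij_continuous gC aphi apsi ir js).
exact: uncurry_diag_continuous.
Qed.

Definition uncurry (g : Cr r M1 (Cr s M2 F)) : Crs r s M1 M2 F :=
  MkCrs (is_Crs_in (uncurry_is_Crs (CrP g))).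

Lemma curryK : cancel curry uncurry.
Proof. by move=> f; apply/val_inj/funext => -[x y]. Qed.

Lemma uncurryK : cancel uncurry curry.
Proof. by move=> g; apply/val_inj/funext => x; apply/val_inj/funext => y. Qed.

End ExponentialLaw.

Theorem theorem4p6 (R : realType) (E1 E2 F : lcsType R)
    (M1 : manifold E1) (M2 : manifold E2) (r s : smoothness)
    (hyp : locally_compact [set: M2] \/
       [\/ [/\ r = Some 0%N, s = Some 0%N & k_space (M1 * M2)%type],
           [/\ le_smoothness 1 r, s = Some 0%N & k_space (M1 * M2 * E1)%type],
           [/\ r = Some 0%N, le_smoothness 1 s & k_space (M1 * M2 * E2)%type]
         | [/\ le_smoothness 1 r, le_smoothness 1 s
             & k_space (M1 * M2 * E1 * E2)%type]]) :
  (exists Phi : {linear Crs r s M1 M2 F -> Cr r M1 (Cr s M2 F)},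
     (forall (f : Crs r s M1 M2 F) (x : M1) (y : M2), Phi f x y = f (x, y)) /\
     is_tvs_iso Phi) /\
  (forall g : M1 -> Cr s M2 F,
     is_Cr r g <-> is_Crs r s (fun p : M1 * M2 => g p.1 p.2)).
Proof.
split; last first.
  move=> g; split; first exact: uncurry_is_Crs.
  by move=> gC; exact: (curry_is_Cr gC).
exists (@curry R E1 E2 F M1 M2 r s); split => //.
exists (uncurry hyp); split.
- exact: curryK.
- exact: uncurryK.
- exact: curry_continuous.
- by apply: uncurry_continuous; exact: uncurryK.
Qed.
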